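(* Let $G=(V,E)$ be a connected, locally finite, vertex-transitive infinite graph with origin $0\in V$, and let $(J_{x,y})_{x,y\in V}$ be an invariant family of coupling constants. Let $\mathbb{P}_\beta$ ($\beta\ge 0$) be the associated bond percolation measure and $\beta_c$ its critical parameter. Then: 1. For every $\beta>\beta_c$, $$\mathbb{P}_\beta[0\longleftrightarrow\infty]\ \ge\ \frac{\beta-\beta_c}{\beta}.$$ 2. For every $\beta<\beta_c$ (with $\beta \geq 0$), the susceptibility is finite, i.e. $$\sum_{x\in V}\mathbb{P}_\beta[0\longleftrightarrow x]<\infty.$$ 3. If $(J_{x,y})_{x,y\in V}$ is finite-range, then for every $\beta<\beta_c$ (with $\beta\ge 0$) there exists $c=c(\beta)>0$ such that $$\mathbb{P}_\beta[0\longleftrightarrow\Lambda_n^c]\le e^{-cn}\qquad\text{for all } n\ge 0.$$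
   Context: $\mathrm{d}(\cdot,\cdot)$ is the graph distance on $G$; for $n\ge 0$, $\Lambda_n:=\{x\in V:\mathrm{d}(x,0)\le n\}$ and $\Lambda_n^c=V\setminus\Lambda_n$. Coupling constants: $J_{x,y}=J_{y,x}\ge 0$ for all $x,y\in V$. They are invariant: there is a group $\Gamma$ of automorphisms of $G$ acting transitively on $V$ such that $J_{\gamma(x),\gamma(y)}=J_{x,y}$ for all $\gamma\in\Gamma$ and $x,y\in V$. They are not assumed to vanish on non-neighbouring pairs. The family is finite-range if there exists $R>0$ such that $J_{x,y}=0$ whenever $\mathrm{d}(x,y)>R$. Percolation measure: under $\mathbb{P}_\beta$, independently for each unordered pair $\{x,y\}$ of distinct vertices of $V$, $\{x,y\}$ is open with probability $1-e^{-\beta J_{x,y}}$ and closed with probability $e^{-\beta J_{x,y}}$. Connections: $x\longleftrightarrow y$ means that there is a finite sequence of vertices $v_0=x,v_1,\dots,v_K=y$ in $V$ with $\{v_k,v_{k+1}\}$ open for every $0\le k<K$ (with $K=0$ allowed, so $x\longleftrightarrow x$ always). For $A\subset V$, $x\longleftrightarrow A$ means that $x\longleftrightarrow y$ for some $y\in A$. The event $0\longleftrightarrow\infty$ means that $0\longleftrightarrow\Lambda_n^c$ for all $n\ge 1$. Critical parameter: $\beta_c:=\inf\{\beta\ge 0:\mathbb{P}_\beta[0\longleftrightarrow\infty]>0\}$, with $\inf\emptyset=+\infty$. *)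

(* Defs.v *)
From HB Require Import structures.
From mathcomp Require Import all_boot all_order all_algebra finmap.
From mathcomp Require Import all_classical all_reals all_analysis.
Import Order.TTheory GRing.Theory Num.Theory.
Import numFieldNormedType.Exports.
Set Implicit Arguments.
Unset Strict Implicit.
Unset Printing Implicit Defensive.
Local Open Scope classical_set_scope.
Local Open Scope ring_scope.

Section Graphs.
Variables (V : choiceType) (adj : rel V).

Definition simple_graph := symmetric adj /\ irreflexive adj.

Definition walk (x y : V) (n : nat) :=
  exists p : seq V, [/\ path adj x p, last x p = y & size p = n].

Definition connected_graph := forall x y, exists n, walk x y n.

Definition locally_finite := forall x, finite_set [set y | adj x y].

Definition automorphism (g : V -> V) :=
  bijective g /\ forall x y, adj (g x) (g y) = adj x y.

Definition vertex_transitive :=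
  forall x y, exists2 g, automorphism g & g x = y.

Definition automorphism_group (Gam : set (V -> V)) :=
  [/\ forall g, Gam g -> automorphism g,
      Gam idfun,
      forall g h, Gam g -> Gam h -> Gam (g \o h) &
      forall g, Gam g -> exists h, [/\ Gam h, cancel g h & cancel h g]].

Definition acts_transitively (Gam : set (V -> V)) :=
  forall x y, exists2 g, Gam g & g x = y.

Lemma walk_lengthP x y :
  (exists n, walk x y n) -> exists n, (fun m => `[< walk x y m >]) n.
Proof. by case=> n xyn; exists n; apply/asboolP. Qed.

(* The value 0 for disconnected pairs is a junk value; it never occurs in a
   connected graph. *)
Definition gdist (x y : V) : nat :=
  if pselect (exists n, walk x y n) is left xy
  then ex_minn (walk_lengthP xy) else 0%N.

Definition gball (o : V) (n : nat) : set V := [set x | (gdist x o <= n)%N].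

End Graphs.

Section Couplings.
Variables (R : realType) (V : choiceType) (adj : rel V) (J : V -> V -> R).

Definition coupling_constants :=
  (forall x y, J x y = J y x) /\ (forall x y, 0 <= J x y).

Definition invariant_couplings :=
  exists Gam : set (V -> V),
    [/\ automorphism_group adj Gam, acts_transitively Gam &
        forall g, Gam g -> forall x y, J (g x) (g y) = J x y].

Definition finite_range :=
  exists2 r : R, 0 < r & forall x y, r < (gdist adj x y)%:R -> J x y = 0.

End Couplings.

Section Percolation.
Variables (R : realType) (V : choiceType).
Variables (d : measure_display) (Om : measurableType d).

(* [opn e] is the event that the unordered pair [e] is open.  Unordered pairs of
   distinct vertices are the [e : {fset V}] with [#|` e| = 2]; the value of
   [opn] on other finite sets is never used. *)
Variable opn : {fset V} -> set Om.

Definition percolation_measure (J : V -> V -> R) (beta : R)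
    (P : probability Om R) :=
  [/\ forall e : {fset V}, #|` e|%fset = 2%N -> measurable (opn e),
      forall x y, x != y ->
        P (opn [fset x; y]%fset) = (1 - expR (- (beta * J x y)))%:E &
      forall F : {fset {fset V}},
        (forall e, e \in F -> #|` e|%fset = 2%N) ->
        P (\bigcap_(e in [set` F]) opn e) = (\prod_(e <- F) P (opn e))%E].

Definition open_pair (w : Om) : rel V :=
  fun x y => (x != y) && (w \in opn [fset x; y]%fset).

Definition connects (x y : V) : set Om :=
  [set w | exists2 p : seq V, path (open_pair w) x p & last x p = y].

Definition connects_set (x : V) (A : set V) : set Om :=
  [set w | exists2 y, A y & connects x y w].

Definition connects_infty (adj : rel V) (o : V) : set Om :=
  [set w | forall n, (1 <= n)%N -> connects_set o (~` gball adj o n) w].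

Definition critical_beta (adj : rel V) (o : V) (P : R -> probability Om R) :
    \bar R :=
  ereal_inf [set beta%:E | beta in
    [set beta : R | 0 <= beta /\ (0 < P beta (connects_infty adj o))%E]].

End Percolation.

(* Main.v *)
Require Import Defs.
From HB Require Import structures.
From mathcomp Require Import all_boot all_order all_algebra finmap.
From mathcomp Require Import all_classical all_reals all_analysis.
From mathcomp Require Import ring lra zify.
Import Order.TTheory GRing.Theory Num.Theory.
Import numFieldNormedType.Exports.
Local Open Scope classical_set_scope.
Local Open Scope ring_scope.
Set Implicit Arguments.
Unset Strict Implicit.
Unset Printing Implicit Defensive.

(** The proof is the one of Duminil-Copin and Tassion, run entirely in finite
volume.  Its pivot is, for a finite set S containing the vertex u,

      phi(S) = sum over x in S and y outside S of
                 P[u <-> x inside S] * (1 - exp (- beta J(x,y))),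

the mean number of open edges leaving S from the cluster of u inside S.  A
parameter beta is called subcritical when phi(S) <= a < 1 for some finite S
containing the origin, and the whole theorem follows from a dichotomy.

If beta is subcritical, a path from u to a target outside S must leave the
cluster of u in S for a last time through an open edge {x,y}, and then run from
y to the target without touching this cluster.  The three pieces depend on
disjoint sets of edges once the cluster is fixed, so that ([prob_exit])

      P[u <-> T] <= sum over x, y of P[u <-> x in S] p(x,y) P[y <-> T].

By invariance the same bound a holds at every vertex, for the translates of S.
Summing over targets, the largest susceptibility chi of a finite window
satisfies chi <= |S| + a chi ([susceptibility_le]).  With finite range, each
exit from S brings the path closer to the far target by a bounded amount only,
and iterating gives exponential decay ([conn_to_decay]).  Finite susceptibility
also excludes percolation ([far_connection_small]).

If beta is not subcritical, let F(t) be the probability that the origin reaches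
the outside of a ball, in a finite window W.  Conditionally on the set of
vertices not connected to the outside, the pivotal edges are those that leave
this set from the cluster of the origin, and Russo's formula gives
t F'(t) >= k (1 - F(t)) as soon as phi >= k for all sets in the ball
([reach_deriv_ge]); k can be taken arbitrarily close to 1 for t >= beta,
because phi is monotone in t.  Integrating between beta and t yields
P_t[0 <-> infinity] >= 1 - beta / t ([supercritical_connects_infty]).

So no subcritical parameter percolates, whereas all parameters above a parameter
that is not subcritical do: the critical parameter separates the two regimes,
and the bound 1 - s / t, for s decreasing to beta_c, is the first claim.

All events in finite volume are predicates on configurations
c : {fset V} -> bool of open pairs that depend on finitely many edges, and their
probabilities are finite product expectations [bern], for which linearity,
independence, monotonicity and Russo's formula are inductions on the list of
edges. *)

(** * Finite sums *)

Section SumLemmas.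
Variables (R : realType) (I : eqType).

Lemma le_sum_mem (r : seq I) (Q : pred I) (F : I -> R) i : i \in r -> Q i ->
  (forall j, 0 <= F j) -> F i <= \sum_(j <- r | Q j) F j.
Proof.
move=> ir Qi F0; rewrite (perm_big _ (perm_to_rem ir)) big_cons Qi lerDl.
exact: sumr_ge0.
Qed.

Lemma sum_eq_indicator (r : seq I) (Q : pred I) (a : I) : uniq r -> a \in r ->
  \sum_(j <- r | Q j) ((a == j)%:R : R) = (Q a)%:R.
Proof.
move=> ur ar; rewrite big_mkcond (bigD1_seq a) //= eqxx big1 ?addr0; first by case: (Q a).
by move=> j ja; rewrite eq_sym (negbTE ja); case: ifP.
Qed.

Lemma ler_sum_sub (r s : seq I) (F : I -> R) :
  uniq r -> uniq s -> {subset r <= s} -> (forall i, 0 <= F i) ->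
  \sum_(i <- r) F i <= \sum_(i <- s) F i.
Proof.
move=> ur us rs F0; rewrite (perm_big [seq i <- s | i \in r]); last first.
  apply: uniq_perm; rewrite ?filter_uniq // => i; rewrite mem_filter.
  by case ir : (i \in r) => //=; rewrite rs.
by rewrite big_filter big_mkcond; apply: ler_sum => i _; case: ifP.
Qed.

Lemma seq_argmax (r : seq I) (F : I -> R) i : i \in r ->
  exists2 j, j \in r & forall k, k \in r -> F k <= F j.
Proof.
elim: r i => [//|a r IH] i _.
case: r IH => [_|a' r IH]; first by exists a; rewrite ?inE // => k; rewrite inE => /eqP ->.
have [j jr jmax] := IH a' (mem_head _ _).
have [aj|ja] := leP (F a) (F j).
  by exists j; [rewrite inE jr orbT|move=> k; rewrite inE => /predU1P[->|/jmax]].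
exists a; first exact: mem_head.
by move=> k; rewrite inE => /predU1P[-> //|/jmax /le_trans]; apply; exact: ltW.
Qed.

End SumLemmas.

(** * Product Bernoulli expectations *)

Section ProductExpectation.
Variables (R : realType) (E : eqType).
Implicit Types (p : E -> R) (s : seq E) (c : E -> bool).
Implicit Types (f g : (E -> bool) -> R) (D : {pred E}).

Definition upd c e b : E -> bool := fun e' => if e' == e then b else c e'.

(** Expectation of [f] when the edges of [s] are resampled independently, [e]
being open with probability [p e], and all other edges keep their state in
[c].  The recursion on the list of edges turns each property of a product
measure used below into an induction on [s]. *)
Fixpoint bern p s f c : R :=
  if s is e :: s' then
    p e * bern p s' f (upd c e true) + (1 - p e) * bern p s' f (upd c e false)
  else f c.

Definition dep (T : Type) D (f : (E -> bool) -> T) :=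
  forall c c', {in D, c =1 c'} -> f c = f c'.

Definition bern_param p := forall e, 0 <= p e <= 1.

Lemma updC c e1 e2 b1 b2 : e1 != e2 ->
  upd (upd c e1 b1) e2 b2 = upd (upd c e2 b2) e1 b1.
Proof.
move=> ne; apply/funext => e; rewrite /upd.
by case: (eqVneq e e2) => // ->; rewrite eq_sym (negbTE ne).
Qed.

Lemma updK c e b1 b2 : upd (upd c e b1) e b2 = upd c e b2.
Proof. by apply/funext => e'; rewrite /upd; case: (e' == e). Qed.

Lemma upd_id c e : upd c e (c e) = c.
Proof. by apply/funext => e'; rewrite /upd; case: eqP => // ->. Qed.

Lemma dep_sub T D D' (f : (E -> bool) -> T) :
  {subset D <= D'} -> dep D f -> dep D' f.
Proof. by move=> sub df c c' cc'; apply: df => e /sub /cc'. Qed.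

Lemma dep_comp T U D (h : T -> U) (f : (E -> bool) -> T) :
  dep D f -> dep D (fun c => h (f c)).
Proof. by move=> df c c' /df ->. Qed.

Lemma dep_comp2 T1 T2 U D (h : T1 -> T2 -> U) (f1 : (E -> bool) -> T1)
    (f2 : (E -> bool) -> T2) :
  dep D f1 -> dep D f2 -> dep D (fun c => h (f1 c) (f2 c)).
Proof. by move=> d1 d2 c c' cc'; rewrite (d1 _ _ cc') (d2 _ _ cc'). Qed.

Lemma bern_le p s f g c : bern_param p -> (forall c, f c <= g c) ->
  bern p s f c <= bern p s g c.
Proof.
move=> p01 fg; elim: s c => [|e s IH] c /=; first exact: fg.
have /andP[p0 p1] := p01 e.
by apply: lerD; apply: ler_wpM2l; rewrite ?subr_ge0 ?IH.
Qed.

Lemma bernD p s f g c :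
  bern p s (fun c => f c + g c) c = bern p s f c + bern p s g c.
Proof. by elim: s c => [|e s IH] c //=; rewrite !IH; ring. Qed.

Lemma bernZ p s a f c : bern p s (fun c => a * f c) c = a * bern p s f c.
Proof. by elim: s c => [|e s IH] c //=; rewrite !IH; ring. Qed.

Lemma bern_cst p s a c : bern p s (fun=> a) c = a.
Proof. by elim: s c => [|e s IH] c //=; rewrite !IH; ring. Qed.

Lemma bern_sum p s (I : Type) (r : seq I) (Q : pred I) (F : I -> (E -> bool) -> R) c :
  bern p s (fun c => \sum_(i <- r | Q i) F i c) c =
  \sum_(i <- r | Q i) bern p s (F i) c.
Proof.
elim: s c => [|e s IH] c //=; rewrite !IH !big_distrr -big_split /=.
exact: eq_bigr.
Qed.

Lemma bern_ge0 p s f c : bern_param p -> (forall c, 0 <= f c) ->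
  0 <= bern p s f c.
Proof. by move=> p01 f0; rewrite -(bern_cst p s 0 c); exact: bern_le. Qed.

Lemma bern_dep p s f D c c' : dep D f -> {in D, c =1 c'} ->
  bern p s f c = bern p s f c'.
Proof.
move=> df; elim: s c c' => [|e s IH] c c' cc' /=; first exact: df.
by congr (_ * _ + _ * _); apply: IH => e' /cc'; rewrite /upd => ->.
Qed.

(** A resampled edge lies in [D] or outside it, so that at each step of the
recursion one of the two factors does not see the edge. *)
Lemma bern_indep D p s f g c : dep D f -> dep [predC D] g ->
  bern p s (fun c => f c * g c) c = bern p s f c * bern p s g c.
Proof.
move=> df dg; elim: s c => [|e s IH] c //=; rewrite !IH.
have [eD|eD] := boolP (e \in D).
- have ge b : bern p s g (upd c e b) = bern p s g c.
    apply: (bern_dep _ _ dg) => e'; rewrite !inE /upd.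
    by case: eqVneq => // ->; rewrite eD.
  by rewrite !ge; ring.
have fe b : bern p s f (upd c e b) = bern p s f c.
  apply: (bern_dep _ _ df) => e'; rewrite /upd.
  by case: eqVneq => // -> ; rewrite (negbTE eD).
by rewrite !fe; ring.
Qed.

Lemma bern_coord p s e c : uniq s -> e \in s ->
  bern p s (fun c => (c e)%:R) c = p e.
Proof.
have de : dep (pred1 e) (fun c => (c e)%:R : R) by move=> c1 c2 ->; rewrite ?inE.
have notin s' c' : e \notin s' -> bern p s' (fun c => (c e)%:R) c' = (c' e)%:R.
  elim: s' c' => [|e' s' IH] c' //=; rewrite inE negb_or => /andP[ne es].
  by rewrite !IH // /upd (negbTE ne); ring.
elim: s c => [|e' s IH] c //= /andP[e's us]; rewrite inE.
have [ee _|ne /= es] := eqVneq e e'; last by rewrite !IH //; ring.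
by rewrite !notin ?ee // /upd eqxx /=; ring.
Qed.

Definition increasing f := forall c c', (forall e, c e -> c' e) -> f c <= f c'.

Lemma bern_le_cfg p s f c c' : bern_param p -> increasing f ->
  (forall e, c e -> c' e) -> bern p s f c <= bern p s f c'.
Proof.
move=> p01 fi; elim: s c c' => [|e s IH] c c' cc' /=; first exact: fi.
have /andP[p0 p1] := p01 e.
apply: lerD; apply: ler_wpM2l; rewrite ?subr_ge0 //;
  by apply: IH => e'; rewrite /upd; case: eqP => // _; exact: cc'.
Qed.

(** Raising the parameters one edge at a time: for an increasing [f] the
branch where the edge is open has the larger expectation. *)
Lemma bern_le_param p q s f c : bern_param p -> bern_param q ->
  (forall e, p e <= q e) -> increasing f -> bern p s f c <= bern q s f c.
Proof.
move=> p01 q01 pq fi; elim: s c => [|e s IH] c //=.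
have /andP[q0 q1] := q01 e.
apply: (@le_trans _ _ (p e * bern q s f (upd c e true) +
                       (1 - p e) * bern q s f (upd c e false))).
  have /andP[p0 p1] := p01 e.
  by apply: lerD; apply: ler_wpM2l; rewrite ?subr_ge0 ?IH.
have : bern q s f (upd c e false) <= bern q s f (upd c e true).
  by apply: bern_le_cfg => // e'; rewrite /upd; case: eqP.
have := pq e; nra.
Qed.

Lemma bern_upd p s f e b c : e \notin s ->
  bern p s (fun c => f (upd c e b)) c = bern p s f (upd c e b).
Proof.
elim: s c => [|e' s IH] c //=; rewrite inE negb_or => /andP[ne es].
by rewrite !IH // !(updC c _ _ ne).
Qed.

(** Russo's formula, from the product rule applied to
p(e) A + (1 - p(e)) B: the derivative of p(e) produces A - B, the effect of
switching [e]. *)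
Lemma bern_russo (p : R -> E -> R) (dp : E -> R) s f c (x : R) : uniq s ->
  (forall e, is_derive x 1 (fun t => p t e) (dp e)) ->
  is_derive x 1 (fun t => bern (p t) s f c)
    (\sum_(e <- s) dp e *
       bern (p x) s (fun c => f (upd c e true) - f (upd c e false)) c).
Proof.
move=> us hp; elim: s us c => [|e s IH] /= => [_|/andP[es us]] c.
  by rewrite big_nil; exact: is_derive_cst.
have bernB s' g h c' : bern (p x) s' (fun c => g c - h c) c' =
    bern (p x) s' g c' - bern (p x) s' h c'.
  rewrite (_ : (fun c => _) = (fun c => g c + (-1) * h c)).
    by rewrite bernD bernZ mulN1r.
  by apply/funext => c''; rewrite mulN1r.
have H1 := IH us (upd c e true); have H0 := IH us (upd c e false).
have := is_deriveD (is_deriveM (hp e) H1)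
  (is_deriveM (is_deriveB (is_derive_cst (1 : R) x (1:R)) (hp e)) H0).
move=> H; apply: (is_derive_eq H) => {H}.
have hE : p x e * bern (p x) s (fun c => f (upd c e true) - f (upd c e false))
      (upd c e true) + (1 - p x e) *
      bern (p x) s (fun c => f (upd c e true) - f (upd c e false)) (upd c e false)
    = bern (p x) s f (upd c e true) - bern (p x) s f (upd c e false).
  by rewrite !bernB !(bern_upd _ _ _ _ es) !updK; ring.
rewrite big_cons /= hE.
rewrite [in RHS](eq_bigr (fun e' => p x e * (dp e' *
     bern (p x) s (fun c => f (upd c e' true) - f (upd c e' false)) (upd c e true))
  + (1 - p x e) * (dp e' *
     bern (p x) s (fun c => f (upd c e' true) - f (upd c e' false)) (upd c e false)))); last first.
  by move=> e1 _; ring.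
rewrite big_split /= -!big_distrr /= /GRing.scale /=.
rewrite -[(_ - _) x]/(1 - p x e).
set A := \sum_(_ <- _) _; set B := \sum_(_ <- _) _.
ring.
Qed.

(** When dp(e) = J(e) (1 - p(e)), which is the case of p(e) = 1 - exp (- t J(e)),
the factor 1 - p(e) is absorbed as the probability that [e] is closed, a
state that is independent of the effect of switching [e]. *)
Lemma bern_russo_closed (p : R -> E -> R) (J : E -> R) s f c (x : R) : uniq s ->
  (forall e, is_derive x 1 (fun t => p t e) (J e * (1 - p x e))) ->
  is_derive x 1 (fun t => bern (p t) s f c)
    (\sum_(e <- s) J e *
       bern (p x) s (fun c => (~~ c e)%:R * (f (upd c e true) - f c)) c).
Proof.
move=> us hp; apply: (is_derive_eq (bern_russo f c us hp)).
apply: eq_big_seq => e es; rewrite -mulrA; congr (_ * _).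
rewrite (_ : (fun c => (~~ c e)%:R * _) = (fun c => (~~ c e)%:R *
   (f (upd c e true) - f (upd c e false)))); last first.
  apply/funext => c'; case ce : (c' e); rewrite ?mul0r //=.
  have -> // : upd c' e false = c'.
  by rewrite -[RHS](upd_id c' e) ce.
rewrite (@bern_indep (pred1 e)).
- congr (_ * _); rewrite (_ : (fun c => _) = (fun c => 1 + (-1) * (c e)%:R)).
    by rewrite bernD bernZ bern_cst bern_coord // mulN1r.
  by apply/funext => c'; case: (c' e); rewrite /= ?mulr1 ?mulr0 ?addr0 ?subrr.
- by move=> c1 c2 ->; rewrite ?inE.
- move=> c1 c2 cc; congr (f _ - f _); apply/funext => e'; rewrite /upd;
    by case: eqVneq => // ne; apply: cc; rewrite !inE.
Qed.

Lemma bern_map (h : E -> E) p s f c : injective h ->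
  bern p (map h s) (fun c => f (c \o h)) c = bern (p \o h) s f (c \o h).
Proof.
move=> hi; elim: s c => [|e s IH] c //=; rewrite !IH.
suff u b : upd c (h e) b \o h = upd (c \o h) e b by rewrite !u.
by apply/funext => e'; rewrite /upd /= (inj_eq hi).
Qed.

End ProductExpectation.

(** * Graph distance *)

Section GraphDistance.
Variables (V : choiceType) (adj : rel V).
Hypotheses (adj_sym : symmetric adj) (adj_conn : connected_graph adj).

Local Notation gd := (gdist adj).

Lemma walk_gdist x y : walk adj x y (gd x y).
Proof.
rewrite /gdist; case: pselect => [xy|[]]; last exact: adj_conn.
by case: ex_minnP => n /asboolP.
Qed.

Lemma gdist_le x y n : walk adj x y n -> (gd x y <= n)%N.
Proof.
move=> w; rewrite /gdist; case: pselect => // xy.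
by case: ex_minnP => m _; apply; apply/asboolP.
Qed.

Lemma gdistxx x : gd x x = 0%N.
Proof. by apply/eqP; rewrite -leqn0; apply: gdist_le; exists [::]. Qed.

Lemma gdist_eq0 x y : gd x y = 0%N -> x = y.
Proof. by move=> xy; have [p [_ py]] := walk_gdist x y; rewrite xy => /size0nil p0; rewrite -py p0. Qed.

Lemma gdist_triangle x y z : (gd x z <= gd x y + gd y z)%N.
Proof.
have [p [xp py ps]] := walk_gdist x y; have [q [yq qz qs]] := walk_gdist y z.
apply: gdist_le; exists (p ++ q).
by rewrite cat_path last_cat size_cat py ps qs xp yq.
Qed.

Lemma walk_sym x y n : walk adj x y n -> walk adj y x n.
Proof.
case=> p [xp <- <-]; exists (rev (belast x p)); split.
- by rewrite rev_path (eq_path (e' := adj)) // => a b; rewrite adj_sym.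
- case: p {xp} => //= a p; rewrite rev_cons last_rcons //.
- by rewrite size_rev size_belast.
Qed.

Lemma gdist_sym x y : gd x y = gd y x.
Proof.
by apply/eqP; rewrite eqn_leq !gdist_le //; apply: walk_sym; exact: walk_gdist.
Qed.

Lemma walk_automorphism g x y n : automorphism adj g ->
  walk adj x y n -> walk adj (g x) (g y) n.
Proof.
move=> [_ ga] [p [xp <- <-]]; exists (map g p); split.
- by rewrite path_map; apply: sub_path xp => a b /=; rewrite ga.
- by rewrite last_map.
- by rewrite size_map.
Qed.

Lemma gdist_automorphism g x y : automorphism adj g -> gd (g x) (g y) = gd x y.
Proof.
move=> ag; apply/eqP; rewrite eqn_leq; apply/andP; split.
  by apply: gdist_le; apply: walk_automorphism => //; exact: walk_gdist.
have [[h gK hK] ga] := ag.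
have ah : automorphism adj h by split; [exists g|move=> a b; rewrite -ga !hK].
rewrite -{1}(gK x) -{1}(gK y).
by apply: gdist_le; apply: walk_automorphism => //; exact: walk_gdist.
Qed.

Hypothesis adj_lf : locally_finite adj.

(** Induction on the radius: a vertex at distance n + 1 has a neighbour at
distance n, and there are finitely many neighbours of finitely many vertices. *)
Lemma gball_finite o n : finite_set (gball adj o n).
Proof.
elim: n => [|n IH].
  apply: (@sub_finite_set _ _ [set o]); last exact: finite_set1.
  by move=> x /=; rewrite /gball /= leqn0 => /eqP /gdist_eq0.
have : finite_set (gball adj o n `|` \bigcup_(x in gball adj o n) [set y | adj x y]).
  rewrite finite_setU; split => //.
  by apply: bigcup_finite => // x _; exact: adj_lf.
apply: sub_finite_set => y yo.
have [p [yp po ps]] := walk_gdist y o.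
case: p yp po ps => [_ yo' _|x p /= /andP[yx xp] po ps].
  by left; rewrite /gball /= -yo' gdistxx.
right; exists x; last by rewrite /= adj_sym.
rewrite /gball /=; apply: (@leq_trans (size p)); first by apply: gdist_le; exists p.
by rewrite -ltnS ps.
Qed.

End GraphDistance.

(** * Connections in a finite window *)

Section FiniteConnections.
Variable V : choiceType.
Implicit Types (c : {fset V} -> bool) (W S : {fset V}) (T : set V).

Definition edges W : seq {fset V} := [seq e <- fpowerset W | #|` e|%fset == 2%N].

Lemma edges_uniq W : uniq (edges W).
Proof. exact/filter_uniq/fset_uniq. Qed.

Lemma mem_edges W e : (e \in edges W) = (#|` e|%fset == 2%N) && (e `<=` W)%fset.
Proof. by rewrite mem_filter fpowersetE. Qed.

Lemma edges_sub W W' : (W `<=` W')%fset -> {subset edges W <= edges W'}.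
Proof.
by move=> WW e; rewrite !mem_edges => /andP[-> /fsubset_trans]; exact.
Qed.

Lemma mem_edges2 W x y : x \in W -> y \in W -> x != y -> [fset x; y]%fset \in edges W.
Proof. by move=> xW yW xy; rewrite mem_edges cardfs2 xy fsubUset !fsub1set xW. Qed.

Definition step c W : rel V :=
  fun x y => [&& x \in W, y \in W, x != y & c [fset x; y]%fset].

Definition conn c W x y : bool :=
  `[< exists2 p : seq V, path (step c W) x p & last x p = y >].

Definition conn_to c W x T : bool :=
  `[< exists y, [/\ y \in W, T y & conn c W x y] >].

Lemma stepC c W x y : step c W x y = step c W y x.
Proof. by rewrite /step eq_sym fsetUC; case: (x \in W); case: (y \in W). Qed.

Lemma conn_refl c W x : conn c W x x.
Proof. by apply/asboolP; exists [::]. Qed.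

Lemma conn_trans c W x y z : conn c W x y -> conn c W y z -> conn c W x z.
Proof.
move=> /asboolP[p xp py] /asboolP[q yq qz]; apply/asboolP; exists (p ++ q).
  by rewrite cat_path xp py.
by rewrite last_cat py.
Qed.

Lemma step_conn c W x y : step c W x y -> conn c W x y.
Proof. by move=> xy; apply/asboolP; exists [:: y] => //=; rewrite xy. Qed.

(** The vertices reached from [x] form the smallest set containing [x] that is
stable under open steps.  Working with such sets [Q] avoids manipulating paths
as sequences. *)
Lemma conn_ind c W x (Q : V -> Prop) : Q x ->
  (forall a b, conn c W x a -> Q a -> step c W a b -> Q b) ->
  forall y, conn c W x y -> Q y.
Proof.
move=> Qx QS y /asboolP[p xp <-]; elim/last_ind: p xp => [//|p b IH].
rewrite rcons_path last_rcons => /andP[xp ab].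
by apply: QS (ab); [apply/asboolP; exists p|exact: IH].
Qed.

Lemma conn_sym c W x y : conn c W x y = conn c W y x.
Proof.
suff H a b : conn c W a b -> conn c W b a by apply/idP/idP; exact: H.
apply: (@conn_ind c W a (fun b => conn c W b a)); first exact: conn_refl.
move=> {}b d _ ba bd; apply: conn_trans ba; apply: step_conn.
by rewrite stepC.
Qed.

(** Only the steps from vertices already reached need to survive: two
configurations that differ away from the explored vertices can be compared. *)
Lemma conn_transfer c c' W W' x y :
  (forall a b, conn c W x a -> step c W a b -> step c' W' a b) ->
  conn c W x y -> conn c' W' x y.
Proof.
move=> H; move: y; apply: (conn_ind (Q := fun y => conn c' W' x y)) => [|a b xa xa' ab]; first exact: conn_refl.
by apply: conn_trans xa' _; apply: step_conn; exact: H ab.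
Qed.

Lemma step_le c c' W W' x y : (forall e, c e -> c' e) -> (W `<=` W')%fset ->
  step c W x y -> step c' W' x y.
Proof.
move=> cc /fsubsetP WW /and4P[xW yW xy cxy].
by apply/and4P; split; [exact: WW|exact: WW| |exact: cc].
Qed.

Lemma conn_le c c' W W' x y : (forall e, c e -> c' e) -> (W `<=` W')%fset ->
  conn c W x y -> conn c' W' x y.
Proof. by move=> cc WW; apply: conn_transfer => a b _; exact: step_le. Qed.

Lemma conn_in c W x y : conn c W x y -> x \in W -> y \in W.
Proof. by move=> xy xW; move: y xy; apply: (conn_ind (Q := fun y => y \in W)) => // a b _ _ /and4P[]. Qed.

Lemma conn_to_le c c' W W' x T T' : (forall e, c e -> c' e) ->
  (W `<=` W')%fset -> T `<=` T' -> conn_to c W x T -> conn_to c' W' x T'.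
Proof.
move=> cc WW TT /asboolP[y [yW Ty xy]]; apply/asboolP; exists y; split.
- by move/fsubsetP : WW; apply.
- exact: TT.
- exact: conn_le xy.
Qed.

Lemma conn_to_trans c W x y T : conn c W x y -> conn_to c W y T -> conn_to c W x T.
Proof.
move=> xy /asboolP[t [tW Tt yt]]; apply/asboolP; exists t; split => //.
exact: conn_trans yt.
Qed.

Lemma step_edge c W x y : step c W x y -> [fset x; y]%fset \in edges W.
Proof. by case/and4P => xW yW xy _; exact: mem_edges2. Qed.

Lemma step_congr c c' W x y : c [fset x; y]%fset = c' [fset x; y]%fset ->
  step c W x y -> step c' W x y.
Proof. by rewrite /step => ->. Qed.

Lemma conn_dep W x y : dep (mem (edges W)) (fun c => conn c W x y).
Proof.
move=> c c' cc; apply/idP/idP; apply: conn_transfer => a b _ ab;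
  apply: step_congr (ab); [|apply/esym]; apply: cc; exact: step_edge ab.
Qed.

Lemma conn_to_dep W x T : dep (mem (edges W)) (fun c => conn_to c W x T).
Proof.
move=> c c' cc; apply/asboolP/asboolP => -[y [yW Ty xy]]; exists y; split => //.
  by rewrite -(@conn_dep _ _ _ c).
by rewrite (@conn_dep _ _ _ _ c').
Qed.

Definition open_cluster c S u : {fset V} := [fset x in S | conn c S u x]%fset.

Lemma in_open_cluster c S u x : (x \in open_cluster c S u) = (x \in S) && conn c S u x.
Proof. by rewrite !inE. Qed.

Lemma open_cluster_sub c S u : (open_cluster c S u `<=` S)%fset.
Proof. by apply/fsubsetP => x; rewrite in_open_cluster => /andP[]. Qed.

(** Exploring the cluster of [u] in [S] reveals only the edges inside [S]
with an endpoint in the cluster, open or not.  Hence, given the cluster, all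
the other edges keep their law. *)
Lemma open_cluster_dep S u C : u \in S ->
  dep [pred e | (e \in edges S) && ~~ [disjoint e & C]%fset]
    (fun c => open_cluster c S u == C).
Proof.
move=> uS.
have H c c' : {in [pred e | (e \in edges S) && ~~ [disjoint e & C]%fset], c =1 c'} ->
    open_cluster c S u = C -> open_cluster c' S u = C.
  move=> cc CE.
  have agree a b : a \in C -> [fset a; b]%fset \in edges S ->
      c [fset a; b]%fset = c' [fset a; b]%fset.
    move=> aC ab; apply: cc; rewrite inE ab /=; apply/negP => /fdisjointP/(_ a).
    by rewrite !inE eqxx aC => /(_ isT).
  have sub x : conn c S u x -> conn c' S u x.
    apply: conn_transfer => a b ua ab; apply: step_congr (ab); apply: agree.
      by rewrite -CE in_open_cluster ua (conn_in ua).
    exact: step_edge ab.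
  apply/fsetP => x; rewrite in_open_cluster; apply/idP/idP => [/andP[_]|xC].
    move: x; apply: (conn_ind (Q := fun x => x \in C)) => [|a b _ aC ab].
      by rewrite -CE in_open_cluster uS conn_refl.
    have {}ab : step c S a b.
      by apply: step_congr (ab); apply/esym/agree => //; exact: step_edge ab.
    move: aC; rewrite -CE !in_open_cluster => /andP[aS ua].
    case/and4P : (ab) => _ -> _ _ /=; apply: conn_trans ua _; exact: step_conn.
  by move: xC; rewrite -{1}CE in_open_cluster => /andP[-> /sub].
move=> c c' cc; apply/eqP/eqP; apply: H => // e /cc; exact: esym.
Qed.

(** Follow the path backwards from the target up to the first vertex that
belongs to the cluster of [u] in [S]; the edge crossed there leaves [S],
since otherwise its other endpoint would be in the cluster too. *)
Lemma last_exit c W S u T : u \in S -> (forall t, T t -> t \notin S) ->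
  conn_to c W u T ->
  exists x y, [/\ x \in open_cluster c S u, y \in W, y \notin S,
    c [fset x; y]%fset & conn_to c (W `\` open_cluster c S u)%fset y T].
Proof.
move=> uS TS /asboolP[t [tW Tt ut]]; set C := open_cluster c S u.
have tC : t \notin C.
  by apply: contra (TS _ Tt); rewrite in_open_cluster => /andP[].
have toT a : conn c (W `\` C)%fset a t -> conn_to c (W `\` C)%fset a T.
  by move=> at_; apply/asboolP; exists t; split => //; rewrite in_fsetD tC.
(* Q is propagated backwards along the path, from [t] to [u]; at [u] the
   first alternative is impossible. *)
pose Q a := (a \notin C /\ conn c (W `\` C)%fset a t) \/
  exists x y, [/\ x \in C, y \in W, y \notin S,
    c [fset x; y]%fset & conn_to c (W `\` C)%fset y T].
suff : Q u by case=> // -[]; rewrite in_open_cluster uS conn_refl.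
move: ut; rewrite conn_sym; move: u @C tC toT @Q uS => u C tC toT Q uS.
apply: (@conn_ind c W t Q); first by left; split => //; exact: conn_refl.
move=> a b ta [[aC at_]|] ab; last by right.
case/and4P : (ab) => aW bW anb cab.
have [bC|bC] := boolP (b \in C); last first.
  left; split => //; apply: conn_trans at_; apply: step_conn.
  apply/and4P; split; [by rewrite in_fsetD bC|by rewrite in_fsetD aC| |].
    by rewrite eq_sym.
  by rewrite fsetUC.
right; exists b, a; split => //; [|by rewrite fsetUC|exact: toT].
apply: contra aC => aS; move: bC; rewrite !in_open_cluster aS => /andP[bS ub] /=.
apply: conn_trans ub _; apply: step_conn.
by apply/and4P; split; rewrite 1?eq_sym // fsetUC.
Qed.

Definition unconnected c W T : {fset V} := [fset x in W | ~~ conn_to c W x T]%fset.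

Lemma in_unconnected c W T x :
  (x \in unconnected c W T) = (x \in W) && ~~ conn_to c W x T.
Proof. by rewrite !inE. Qed.

(** The exploration from the target: for [S] in [W] disjoint from [T], the set
of vertices not connected to [T] is [S] exactly when the edges between [S] and
its complement are closed and every vertex outside [S] reaches [T] outside
[S].  The edges inside [S] are thus not revealed. *)
Lemma unconnected_dep W T S :
  dep [pred e | (e \in edges W) && ~~ (e `<=` S)%fset]
    (fun c => unconnected c W T == S).
Proof.
have H c c' : {in [pred e | (e \in edges W) && ~~ (e `<=` S)%fset], c =1 c'} ->
    unconnected c W T = S -> unconnected c' W T = S.
  move=> cc SE.
  have agree a b : (a \notin S) || (b \notin S) -> [fset a; b]%fset \in edges W ->
      c [fset a; b]%fset = c' [fset a; b]%fset.
    move=> aS ab; apply: cc; rewrite inE ab /=; apply/negP.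
    by rewrite fsubUset !fsub1set => /andP[aS' bS']; rewrite aS' bS' in aS.
  apply/fsetP => x; rewrite in_unconnected; apply/idP/idP => [/andP[xW]|xS].
    apply: contraR => xS.
    have : conn_to c W x T.
      by move: xS; rewrite -SE in_unconnected xW /= negbK.
    case/asboolP=> t [tW Tt xt]; apply/asboolP; exists t; split => //.
    apply: conn_transfer (xt) => a b xa ab; apply: step_congr (ab).
    apply: agree; last exact: step_edge ab.
    rewrite -SE in_unconnected negb_and negbK.
    suff -> : conn_to c W a T by rewrite orbT.
    apply/asboolP; exists t; split => //; apply: conn_trans xt.
    by rewrite conn_sym.
  move: (xS); rewrite -{1}SE in_unconnected => /andP[-> _] /=.
  apply/negP => /asboolP[t [tW Tt xt]].
  suff : t \in S.
    rewrite -SE in_unconnected => /andP[_ /negP]; apply; apply/asboolP.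
    by exists t; split => //; exact: conn_refl.
  move: t xt {tW Tt}; apply: (conn_ind (Q := fun t => t \in S)) => // a b _ aS ab.
  apply: contraLR aS => bS; rewrite -SE in_unconnected negb_and negbK.
  have bW : b \in W by case/and4P: ab.
  have : conn_to c W b T.
    by move: bS; rewrite -SE in_unconnected bW /= negbK.
  move=> bT; suff -> : conn_to c W a T by rewrite orbT.
  apply: conn_to_trans bT; apply: step_conn; apply: step_congr (ab).
  by apply/esym/agree; [rewrite bS orbT|exact: step_edge ab].
move=> c c' cc; apply/eqP/eqP; apply: H => // e /cc; exact: esym.
Qed.

End FiniteConnections.

(** * Opening probabilities *)

Section EdgeParameters.
Variables (R : realType) (V : choiceType) (J : V -> V -> R).
Hypothesis HJ : coupling_constants J.

(** Each of the two orders of the pair is counted once, whence the division. *)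
Definition edge_coupling (e : {fset V}) : R :=
  (\sum_(x <- e) \sum_(y <- e | y != x) J x y) / 2.

Definition edge_prob (b : R) (e : {fset V}) : R :=
  1 - expR (- (b * edge_coupling e)).

Lemma big_fset2 (F : V -> R) x y : x != y ->
  \sum_(z <- [fset x; y]%fset) F z = F x + F y.
Proof.
move=> xy; have xyE : perm_eq [fset x; y]%fset [:: x; y].
  apply: uniq_perm; rewrite ?fset_uniq //= ?inE ?xy //.
  by move=> z; rewrite !inE.
by rewrite (perm_big _ xyE) !big_cons big_nil /= addr0.
Qed.

Lemma edge_coupling2 x y : x != y -> edge_coupling [fset x; y]%fset = J x y.
Proof.
move=> xy; rewrite /edge_coupling big_fset2 //.
rewrite big_mkcond /= big_fset2 // eqxx /= eq_sym xy add0r.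
rewrite big_mkcond /= big_fset2 // eqxx /= xy addr0.
have [Js _] := HJ; rewrite (Js y x); lra.
Qed.

Lemma edge_coupling_ge0 e : 0 <= edge_coupling e.
Proof.
have [_ J0] := HJ.
by apply: divr_ge0 => //; apply: sumr_ge0 => x _; exact: sumr_ge0.
Qed.

Lemma edge_prob2 b x y : x != y ->
  edge_prob b [fset x; y]%fset = 1 - expR (- (b * J x y)).
Proof. by move=> xy; rewrite /edge_prob edge_coupling2. Qed.

Lemma edge_prob_param b : 0 <= b -> bern_param (edge_prob b).
Proof.
move=> b0 e; rewrite /edge_prob.
have := expR_ge0 (- (b * edge_coupling e)).
have : expR (- (b * edge_coupling e)) <= 1.
  by rewrite -expR0 ler_expR oppr_le0 mulr_ge0 // edge_coupling_ge0.
by move=> h1 h0; apply/andP; split; lra.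
Qed.

Lemma edge_prob_le a b e : a <= b -> edge_prob a e <= edge_prob b e.
Proof.
move=> ab; rewrite /edge_prob lerD2l lerN2 ler_expR lerN2.
by rewrite ler_wpM2r // edge_coupling_ge0.
Qed.

(** This is 1 - exp (- x) <= x; it is how the probabilities in [phi]
replace the coupling constants that Russo's formula produces. *)
Lemma edge_prob_le_coupling b e : edge_prob b e <= b * edge_coupling e.
Proof. by rewrite /edge_prob; have := expR_ge1Dx (- (b * edge_coupling e)); lra. Qed.

Lemma is_derive_edge_prob (b : R) e :
  is_derive b 1 (fun t => edge_prob t e) (edge_coupling e * (1 - edge_prob b e)).
Proof.
rewrite /edge_prob.
set k := edge_coupling e.
have h1 : is_derive b 1 (fun t : R => - (t * k)) (- k).
  apply: (is_derive_eq (is_deriveN (is_deriveM (is_derive_id b (1 : R))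
    (is_derive_cst k b (1 : R))))).
  by rewrite /GRing.scale /= mulr0 add0r mulr1.
have h2 : is_derive b 1 (fun t : R => expR (- (t * k))) (expR (- (b * k)) * - k).
  exact: is_derive1_comp.
apply: (is_derive_eq (is_deriveB (is_derive_cst (1 : R) b (1:R)) h2)).
by rewrite /GRing.scale /=; ring.
Qed.

End EdgeParameters.

Lemma fset_pairP (V : choiceType) (e : {fset V}) : #|` e|%fset = 2%N ->
  exists x y, x != y /\ e = [fset x; y]%fset.
Proof.
have := fset_uniq e; have : forall z, (z \in enum_fset e) = (z \in e) by [].
case: (enum_fset e) => [|x [|y [|]]] //= eE; rewrite inE andbT => xy _.
by exists x, y; split => //; apply/fsetP => z; rewrite -eE !inE.
Qed.

(** * The law of finitely many edges *)

Section Law.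
Variables (R : realType) (V : choiceType) (J : V -> V -> R).
Hypothesis HJ : coupling_constants J.
Variables (d : measure_display) (Om : measurableType d) (opn : {fset V} -> set Om).
Variables (b : R) (P : probability Om R).
Hypotheses (b0 : 0 <= b) (HP : percolation_measure opn J b P).

Definition cfg (w : Om) : {fset V} -> bool := fun e => w \in opn e.

Definition prob (f : ({fset V} -> bool) -> bool) : R := fine (P [set w | f (cfg w)]).

Definition cylinder (A B : seq {fset V}) : set Om :=
  [set w | all (cfg w) A && all (predC (cfg w)) B].

Local Notation pairs s := (forall e, e \in (s : seq {fset V}) -> #|` e|%fset = 2%N).

Lemma measurable_opn e : #|` e|%fset = 2%N -> measurable (opn e).
Proof. by have [mo _ _] := HP; exact: mo. Qed.

Lemma cfgE e : [set w | cfg w e] = opn e.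
Proof. by apply/seteqP; split => w /=; rewrite /cfg inE. Qed.

Lemma P_opn e : #|` e|%fset = 2%N -> P (opn e) = (edge_prob J b e)%:E.
Proof.
move=> /fset_pairP[x [y [xy ->]]]; have [_ Po _] := HP.
by rewrite Po // edge_prob2.
Qed.

Lemma measurable_cfg (s : seq {fset V}) (f : ({fset V} -> bool) -> bool) :
  pairs s -> dep (mem s) f -> measurable [set w | f (cfg w)].
Proof.
elim: s f => [|e s IH] f ps df.
  have -> : [set w | f (cfg w)] = if f (fun=> false) then setT else set0.
    apply/seteqP; split => w /=; rewrite (df (cfg w) (fun=> false)) //;
      by case: (f _).
  by case: ifP.
have pe : #|` e|%fset = 2%N by apply: ps; rewrite inE eqxx.
have -> : [set w | f (cfg w)] =
    (opn e `&` [set w | f (upd (cfg w) e true)]) `|`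
    (~` opn e `&` [set w | f (upd (cfg w) e false)]).
  rewrite -cfgE; apply/seteqP; split => w /=.
    have := upd_id (cfg w) e; case: (cfg w e) => -> fw; by [left|right; split].
  by have := upd_id (cfg w) e; case: (cfg w e) => -> [[he fw]|[he fw]].
have dfb bb : dep (mem s) (fun c => f (upd c e bb)).
  move=> c c' cc; apply: df => e'; rewrite inE /upd; case: eqP => //= _.
  exact: cc.
apply: measurableU; apply: measurableI.
- exact: measurable_opn.
- by apply: (IH (fun c => f (upd c e true))) => // e' es; apply: ps; rewrite inE es orbT.
- by apply: measurableC; exact: measurable_opn.
- by apply: (IH (fun c => f (upd c e false))) => // e' es; apply: ps; rewrite inE es orbT.
Qed.

Lemma cylinder_dep (A B : seq {fset V}) :
  dep (mem (A ++ B)) (fun c : {fset V} -> bool => all c A && all (predC c) B).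
Proof.
move=> c c' cc; have {}cc e : e \in A ++ B -> c e = c' e by exact: cc.
by congr (_ && _); apply: eq_in_all => e eA /=; rewrite cc // mem_cat eA ?orbT.
Qed.

Lemma measurable_cylinder A B : pairs A -> pairs B -> measurable (cylinder A B).
Proof.
move=> pA pB; apply: (measurable_cfg _ (@cylinder_dep A B)).
by move=> e; rewrite mem_cat => /orP[/pA|/pB].
Qed.

(** The law gives the probability that a finite set of edges is open;
closed edges are added one at a time by taking differences. *)
Lemma P_cylinder A B : uniq (A ++ B) -> pairs A -> pairs B ->
  P (cylinder A B) =
  (\prod_(e <- A) edge_prob J b e * \prod_(e <- B) (1 - edge_prob J b e))%:E.
Proof.
elim: B A => [|e B IH] A.
  rewrite cats0 big_nil mulr1 => uA pA _.
  have [_ _ indep] := HP.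
  have -> : cylinder A [::] = \bigcap_(e in [set` [fset e in A]%fset]) opn e.
    apply/seteqP; split => w /=.
      move=> /andP[/allP wA _] e /=; rewrite !inE => /wA.
      by rewrite /cfg inE.
    move=> wA; rewrite /cylinder /= andbT; apply/allP => e eA.
    by rewrite /cfg inE; apply: wA; rewrite /= !inE.
  rewrite indep; last by move=> e; rewrite !inE; exact: pA.
  rewrite (perm_big A) /=; last first.
    by apply: uniq_perm; [exact: fset_uniq|exact: uA|move=> e; rewrite !inE].
  rewrite -prodEFin big_seq [RHS]big_seq; apply: eq_bigr => e eA.
  by rewrite P_opn // pA.
move=> uAB pA pB.
have peB e' : e' \in B -> #|` e'|%fset = 2%N by move=> h; apply: pB; rewrite inE h orbT.
have pe : #|` e|%fset = 2%N by apply: pB; rewrite inE eqxx.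
have pA' e' : e' \in e :: A -> #|` e'|%fset = 2%N.
  by rewrite inE => /predU1P[->|/pA].
have u1 : uniq ((e :: A) ++ B).
  by move: uAB; rewrite -(perm_uniq (permEl (perm_catCA [:: e] A B))).
have u2 : uniq (A ++ B) by case/andP: u1.
have E1 := IH _ u1 pA' peB; have E2 := IH _ u2 pA peB.
have mC := measurable_cylinder pA peB.
have DI : P (cylinder A B) = (P (cylinder A B `\` opn e) + P (cylinder A B `&` opn e))%E.
  exact: measureDI (measurable_opn pe).
move: DI; have -> : cylinder A B `\` opn e = cylinder A (e :: B).
  rewrite -cfgE; apply/seteqP; split => w /=; rewrite /cylinder /=.
    by move=> [/andP[-> ->] /negP ->].
  by move=> /and3P[-> /negP we ->].
have -> : cylinder A B `&` opn e = cylinder (e :: A) B.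
  rewrite -cfgE; apply/seteqP; split => w /=; rewrite /cylinder /=.
    by move=> [/andP[-> ->] ->].
  by move=> /andP[/andP[-> ->] ->].
have -> : P (cylinder A (e :: B)) = (fine (P (cylinder A (e :: B))))%:E.
  rewrite fineK // fin_num_measure //.
  by apply: (measurable_cylinder pA) => e' e'B; exact: pB.
rewrite E1 E2 -EFinD => -[]; rewrite !big_cons => H; congr _%:E.
by move: H; move: (fine _) => z H; lra.
Qed.

(** The edges of [A] (open) and [B] (closed) are those already examined; one
more edge is examined at each step, as in the recursion defining [bern]. *)
Lemma P_cylinder_cfg s A B (f : ({fset V} -> bool) -> bool) c :
  uniq (s ++ A ++ B) -> pairs s -> pairs A -> pairs B ->
  dep (mem (s ++ A ++ B)) f -> all c A -> all (predC c) B ->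
  P (cylinder A B `&` [set w | f (cfg w)]) =
  (\prod_(e <- A) edge_prob J b e * \prod_(e <- B) (1 - edge_prob J b e) *
   bern (edge_prob J b) s (fun c => (f c)%:R) c)%:E.
Proof.
elim: s A B c => [|e s IH] A B c us ps pA pB df cA cB /=.
  have fE w : cylinder A B w -> f (cfg w) = f c.
    case/andP=> /allP wA /allP wB; apply: df => e /=.
    rewrite -[_ \in _]/(e \in A ++ B) mem_cat => /orP[] h; first by rewrite (wA _ h) (allP cA _ h).
    by rewrite (negbTE (wB _ h)) (negbTE (allP cB _ h)).
  case fc : (f c).
    rewrite mulr1 -P_cylinder //; congr (P _); apply/seteqP; split => w /=.
      by case.
    by move=> wAB; split => //; rewrite fE.
  rewrite mulr0 (_ : _ `&` _ = set0) ?measure0 //.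
  by apply/seteqP; split => w //= [/fE ->]; rewrite fc.
have pe : #|` e|%fset = 2%N by apply: ps; rewrite inE eqxx.
have ps' e' : e' \in s -> #|` e'|%fset = 2%N by move=> h; apply: ps; rewrite inE h orbT.
have pcons C : pairs C -> pairs (e :: C).
  by move=> pC e'; rewrite inE => /predU1P[->|/pC].
have [esAB usAB] : e \notin s ++ A ++ B /\ uniq (s ++ A ++ B) by case/andP: us.
have eA : e \notin A by apply: contra esAB => h; rewrite !mem_cat h orbT.
have eB : e \notin B by apply: contra esAB => h; rewrite !mem_cat h !orbT.
have all_upd bb C (h : pred {fset V} -> pred {fset V}) : e \notin C ->
   (forall c1 c2 : pred {fset V}, forall e, c1 e = c2 e -> h c1 e = h c2 e) ->
   all (h (upd c e bb)) C = all (h c) C.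
  move=> eC hE; apply: eq_in_all => e' e'C; apply: hE; rewrite /upd.
  by case: eqP => // ee; rewrite -ee e'C in eC.
have mf : measurable [set w | f (cfg w)].
  apply: (measurable_cfg _ df) => e'; rewrite /= inE !mem_cat.
  by case/predU1P=> [->|/or3P[/ps'|/pA|/pB]].
have mC : measurable (cylinder A B `&` [set w | f (cfg w)]).
  by apply: measurableI => //; exact: measurable_cylinder.
have -> : P (cylinder A B `&` [set w | f (cfg w)]) =
   (P ((cylinder A B `&` [set w | f (cfg w)]) `\` opn e) +
    P (cylinder A B `&` [set w | f (cfg w)] `&` opn e))%E.
  exact: measureDI (measurable_opn pe).
have -> : (cylinder A B `&` [set w | f (cfg w)]) `\` opn e =
    cylinder A (e :: B) `&` [set w | f (cfg w)].
  rewrite -cfgE; apply/seteqP; split => w /=; rewrite /cylinder /=.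
    by move=> [[/andP[-> ->] ->] /negP ->].
  by move=> [/and3P[-> /negP we ->]].
have -> : cylinder A B `&` [set w | f (cfg w)] `&` opn e =
    cylinder (e :: A) B `&` [set w | f (cfg w)].
  rewrite -cfgE; apply/seteqP; split => w /=; rewrite /cylinder /=.
    by move=> [[/andP[-> ->] ->] ->].
  by move=> [/andP[/andP[-> ->] ->]].
have mem_eq A' B' e' : (e' \in s ++ A' ++ B') = [|| e' \in s, e' \in A' | e' \in B'].
  by rewrite !mem_cat.
have u1 : uniq (s ++ A ++ e :: B).
  have : perm_eq (s ++ A ++ e :: B) (e :: s ++ A ++ B).
    by rewrite !catA; exact: (permEl (perm_catCA (s ++ A) [:: e] B)).
  by move/perm_uniq ->.
have u2 : uniq (s ++ (e :: A) ++ B).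
  have : perm_eq (s ++ (e :: A) ++ B) (e :: s ++ A ++ B).
    exact: (permEl (perm_catCA s [:: e] (A ++ B))).
  by move/perm_uniq ->.
have d1 : dep (mem (s ++ A ++ e :: B)) f.
  suff sub e' : e' \in (e :: s) ++ A ++ B -> e' \in s ++ A ++ e :: B.
    by apply: dep_sub df => e' /sub.
  by rewrite inE !mem_eq inE; case: (e' == e) => //=; rewrite !orbT.
have d2 : dep (mem (s ++ (e :: A) ++ B)) f.
  suff sub e' : e' \in (e :: s) ++ A ++ B -> e' \in s ++ (e :: A) ++ B.
    by apply: dep_sub df => e' /sub.
  by rewrite inE !mem_eq inE; case: (e' == e) => //=; rewrite !orbT.
have cA1 : all (upd c e false) A by rewrite (all_upd _ _ id).
have cB1 : all (predC (upd c e false)) (e :: B).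
  rewrite /= {1}/upd eqxx /= (all_upd false B (fun p => predC p)) //.
  by move=> c1 c2 e' /= ->.
have cA2 : all (upd c e true) (e :: A) by rewrite /= {1}/upd eqxx /= (all_upd _ _ id).
have cB2 : all (predC (upd c e true)) B.
  rewrite (all_upd true B (fun p => predC p)) //.
  by move=> c1 c2 e' /= ->.
rewrite (IH A (e :: B) _ u1 ps' pA (pcons _ pB) d1 cA1 cB1).
rewrite (IH (e :: A) B _ u2 ps' (pcons _ pA) pB d2 cA2 cB2).
by rewrite -EFinD !big_cons; congr _%:E; ring.
Qed.

Lemma prob_bern s (f : ({fset V} -> bool) -> bool) :
  uniq s -> pairs s -> dep (mem s) f ->
  prob f = bern (edge_prob J b) s (fun c => (f c)%:R) (fun=> false).
Proof.
move=> us ps df; rewrite /prob.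
have := @P_cylinder_cfg s [::] [::] f (fun=> false).
rewrite !cats0 !big_nil !mul1r => /(_ us ps) H.
rewrite -[RHS]/(fine _%:E) -H //; congr (fine (P _)).
by apply/seteqP; split => w //= [].
Qed.

Lemma edges_pairs W : pairs (edges W).
Proof. by move=> e; rewrite mem_edges => /andP[/eqP]. Qed.

(** The bridge between the probability space and finite product expectations. *)
Lemma prob_edges W (f : ({fset V} -> bool) -> bool) : dep (mem (edges W)) f ->
  prob f = bern (edge_prob J b) (edges W) (fun c => (f c)%:R) (fun=> false).
Proof. by move=> df; apply: prob_bern => //; [exact: edges_uniq|exact: edges_pairs]. Qed.

End Law.

(** * Leaving a finite set *)

Section FixedParameter.
Variables (R : realType) (V : choiceType) (J : V -> V -> R).
Hypothesis HJ : coupling_constants J.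
Variables (d : measure_display) (Om : measurableType d) (opn : {fset V} -> set Om).
Variables (b : R) (P : probability Om R).
Hypotheses (b0 : 0 <= b) (HP : percolation_measure opn J b P).

Local Notation prob := (prob opn P).
Local Notation p := (edge_prob J b).
Local Notation E U f := (bern p (edges U) f (fun=> false)).
Implicit Types (S W U C : {fset V}) (T : set V) (f g : ({fset V} -> bool) -> bool).

Let p01 : bern_param p := edge_prob_param HJ b0.

Lemma prob_E U f : dep (mem (edges U)) f -> prob f = E U (fun c => (f c)%:R).
Proof. exact: (prob_edges HJ HP). Qed.

Lemma prob_ge0 f : 0 <= prob f.
Proof. exact/fine_ge0/measure_ge0. Qed.

Lemma prob_le U f g : dep (mem (edges U)) f -> dep (mem (edges U)) g ->
  (forall c, f c -> g c) -> prob f <= prob g.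
Proof.
move=> df dg fg; rewrite (prob_E df) (prob_E dg); apply: bern_le => // c.
by rewrite ler_nat; case fc : (f c) => //; rewrite fg.
Qed.

Lemma prob_le1 U f : dep (mem (edges U)) f -> prob f <= 1.
Proof.
move=> df; rewrite (prob_E df) -[leRHS](bern_cst p (edges U) 1 (fun=> false)).
by apply: bern_le => // c; rewrite -[leRHS]/(1%:R) ler_nat leq_b1.
Qed.

Lemma dep_edges_sub (T : Type) U U' (f : ({fset V} -> bool) -> T) : (U `<=` U')%fset ->
  dep (mem (edges U)) f -> dep (mem (edges U')) f.
Proof. by move=> UU; apply: dep_sub => e; exact: edges_sub. Qed.

(** The quantity phi(S) for the vertex [u], the outer endpoint [y] being
restricted to a finite window [W] so that all the sums are finite. *)
Definition phi S u W : R :=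
  \sum_(x <- S) \sum_(y <- (W `\` S)%fset)
    prob (fun c => conn c S u x) * p [fset x; y]%fset.

(** Decompose according to the cluster [C] of [u] in [S] and the last exit
from it.  That the cluster is [C], that {x,y} is open and that [y] is
connected to [T] off [C] depend on disjoint sets of edges.  Summing over the
sets [C] containing [x] recovers the probability that [u] is connected to [x]
in [S].  This argument replaces the van den Berg-Kesten inequality. *)
Lemma prob_exit S u W T : u \in S -> (forall t, T t -> t \notin S) ->
  prob (fun c => conn_to c W u T) <=
  \sum_(x <- S) \sum_(y <- (W `\` S)%fset)
    prob (fun c => conn c S u x) * p [fset x; y]%fset *
    prob (fun c => conn_to c W y T).
Proof.
move=> uS TS; set U := (W `|` S)%fset.
have WU : (W `<=` U)%fset by exact: fsubsetUl.
have SU : (S `<=` U)%fset by exact: fsubsetUr.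
rewrite (prob_E (dep_edges_sub WU (@conn_to_dep _ W u T))).
pose F (x y : V) C (c : {fset V} -> bool) : R := (open_cluster c S u == C)%:R *
  ((c [fset x; y]%fset)%:R * (conn_to c (W `\` C)%fset y T)%:R).
have F0 x y C c : 0 <= F x y C c by rewrite !mulr_ge0.
apply: (@le_trans _ _ (E U (fun c => \sum_(x <- S) \sum_(y <- (W `\` S)%fset)
    \sum_(C <- fpowerset S | x \in C) F x y C c))).
  apply: bern_le => // c; case uT : (conn_to c W u T); last first.
    by apply: sumr_ge0 => x _; apply: sumr_ge0 => y _; apply: sumr_ge0.
  have [x [y [xC yW yS cxy yT]]] := last_exit uS TS uT.
  have xS : x \in S by move/fsubsetP : (open_cluster_sub c S u); apply.
  have ySW : y \in (W `\` S)%fset by rewrite in_fsetD yS.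
  have CS : open_cluster c S u \in fpowerset S by rewrite fpowersetE open_cluster_sub.
  apply: le_trans (le_sum_mem xS isT _); last first.
    by move=> x'; apply: sumr_ge0 => y' _; apply: sumr_ge0.
  apply: le_trans (le_sum_mem ySW isT _); last by move=> y'; apply: sumr_ge0.
  apply: le_trans (le_sum_mem (i := open_cluster c S u) CS xC _) => //.
  by rewrite /F eqxx cxy yT !mulr1.
rewrite bern_sum big_seq [leRHS]big_seq; apply: ler_sum => x xS.
rewrite bern_sum big_seq [leRHS]big_seq; apply: ler_sum => y.
rewrite in_fsetD => /andP[yS yW].
have xy : x != y by apply: contraNneq yS => <-.
have xyU : [fset x; y]%fset \in edges U.
  by apply: mem_edges2 => //; rewrite in_fsetU ?xS ?yW ?orbT.
rewrite bern_sum -mulrA.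
have -> : prob (fun c => conn c S u x) =
    \sum_(C <- fpowerset S | x \in C) E U (fun c => (open_cluster c S u == C)%:R).
  rewrite (prob_E (dep_edges_sub SU (@conn_dep _ S u x))) -bern_sum.
  congr bern; apply/funext => c; rewrite sum_eq_indicator ?fset_uniq //.
    by rewrite in_open_cluster xS.
  by rewrite fpowersetE open_cluster_sub.
rewrite big_distrl /=; apply: ler_sum => C xC.
rewrite /F (@bern_indep _ _ [pred e | (e \in edges S) && ~~ [disjoint e & C]%fset]).
- apply: ler_wpM2l; first by apply: bern_ge0.
  rewrite (@bern_indep _ _ (pred1 [fset x; y]%fset)).
  + rewrite bern_coord ?edges_uniq //; apply: ler_wpM2l.
      by case/andP: (p01 [fset x; y]%fset).
    rewrite (prob_E (dep_edges_sub WU (@conn_to_dep _ W y T))).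
    apply: bern_le => // c; rewrite ler_nat.
    case h : (conn_to c (W `\` C)%fset y T) => //.
    by rewrite (conn_to_le (c := c) _ _ _ h) // fsubsetDl.
  + by move=> c c' ->; rewrite ?inE.
  + apply: dep_sub (dep_comp (fun bb : bool => (bb%:R : R)) (@conn_to_dep _ _ y T)) => e.
    rewrite -[_ \in _]/(e \in edges _) mem_edges fsubsetD => /and3P[_ _ /fdisjointP dis].
    by apply/negP => /eqP ee; have := dis x; rewrite ee !inE eqxx xC => /(_ isT).
- exact: (dep_comp (fun bb : bool => (bb%:R : R)) (@open_cluster_dep _ _ _ C uS)).
- apply: (dep_comp2 (fun x y : R => x * y)).
    move=> c c' cc; rewrite cc // !inE mem_edges fsubUset !fsub1set (negbTE yS).
    by rewrite !andbF.
  apply: dep_sub (dep_comp (fun bb : bool => (bb%:R : R)) (@conn_to_dep _ _ y T)) => e.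
  rewrite -[_ \in _]/(e \in edges _) !inE mem_edges fsubsetD => /and3P[_ _ ->].
  by rewrite andbF.
Qed.

End FixedParameter.

(** * Iterating the exit inequality *)

Section Subcritical.
Variables (R : realType) (V : choiceType) (J : V -> V -> R).
Hypothesis HJ : coupling_constants J.
Variables (d : measure_display) (Om : measurableType d) (opn : {fset V} -> set Om).
Variables (b : R) (P : probability Om R).
Hypotheses (b0 : 0 <= b) (HP : percolation_measure opn J b P).

Local Notation prob := (prob opn P).
Local Notation p := (edge_prob J b).
Local Notation phi := (phi J opn b P).
Implicit Types (W U C : {fset V}) (T : set V).

Let p0 e : 0 <= p e. Proof. by have /andP[] := edge_prob_param HJ b0 e. Qed.

Variables (S : V -> {fset V}) (a : R).
Hypotheses (S_self : forall u, u \in S u) (phi_le : forall u W, phi (S u) u W <= a).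

Let a0 : V -> 0 <= a.
Proof.
move=> u; apply: le_trans (phi_le u fset0).
by apply: sumr_ge0 => x _; apply: sumr_ge0 => y _; rewrite mulr_ge0 ?(prob_ge0 opn P) ?p0.
Qed.

(** At a vertex [u] of the window with the largest susceptibility chi, the
targets inside [S u] contribute at most [N] and the others, by the exit
inequality, at most a chi. *)
Lemma susceptibility_le (N : R) : a < 1 ->
  (forall u, (#|` S u|%fset)%:R <= N) -> forall W u, u \in W ->
  \sum_(v <- W) prob (fun c => conn c W u v) <= N / (1 - a).
Proof.
move=> a1 SN W.
pose chi u := \sum_(v <- W) prob (fun c => conn c W u v).
have pW u v := @conn_dep V W u v.
suff main u : u \in W -> (forall v, v \in W -> chi v <= chi u) ->
    chi u <= N / (1 - a).
  move=> u uW; have [j jW jmax] := seq_argmax chi uW.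
  exact: le_trans (jmax _ uW) (main _ jW jmax).
move=> uW umax; rewrite ler_pdivlMr ?subr_gt0 // mulrBr mulr1 lerBlDr.
have chi0 : 0 <= chi u by apply: sumr_ge0 => v _; exact: prob_ge0.
rewrite {1}/chi (bigID (fun v => v \in S u)) /=; apply: lerD.
  apply: le_trans (SN u).
  apply: (@le_trans _ _ (\sum_(v <- W | v \in S u) 1)).
    by apply: ler_sum => v _; exact: (prob_le1 HJ b0 HP (@conn_dep _ _ _ _)).
  rewrite -big_filter big_const_seq count_predT iter_addr addr0 ler_nat.
  apply: uniq_leq_size; first exact/filter_uniq/fset_uniq.
  by move=> v; rewrite mem_filter => /andP[].
apply: (@le_trans _ _ (\sum_(x <- S u) \sum_(y <- (W `\` S u)%fset)
    prob (fun c => conn c (S u) u x) * p [fset x; y]%fset * chi y)).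
  apply: (@le_trans _ _ (\sum_(v <- W | v \notin S u)
     \sum_(x <- S u) \sum_(y <- (W `\` S u)%fset)
    prob (fun c => conn c (S u) u x) * p [fset x; y]%fset *
      prob (fun c => conn c W y v))).
    rewrite big_seq_cond [leRHS]big_seq_cond; apply: ler_sum => v /andP[vW vS].
    have connE y : (fun c => conn c W y v) = (fun c => conn_to c W y [set v]).
      apply/funext => c; apply/idP/asboolP => [yv|[t [_ -> //]]].
      by exists v.
    rewrite connE; under eq_bigr do under eq_bigr do rewrite connE.
    by apply: (prob_exit (T := [set v]) HJ b0 HP W (S_self u)) => t ->.
  rewrite exchange_big /=; apply: ler_sum => x _.
  rewrite exchange_big /=; apply: ler_sum => y _.
  rewrite -big_distrr /= ler_wpM2l ?mulr_ge0 ?prob_ge0 //.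
  rewrite big_mkcond /=; apply: ler_sum => v _; case: ifP => // _.
  exact: prob_ge0.
apply: (@le_trans _ _ (phi (S u) u W * chi u)); last first.
  by rewrite mulrC ler_wpM2l.
rewrite /phi big_distrl /=; apply: ler_sum => x _.
rewrite big_distrl /= big_seq [leRHS]big_seq; apply: ler_sum => y.
rewrite in_fsetD => /andP[_ yW].
by rewrite ler_wpM2l ?mulr_ge0 ?prob_ge0 ?umax.
Qed.

(** [T k u] plays the role of the vertices that cannot be reached from [u] in
fewer than k exits; after one exit, what is far from [u] is still far from the
new starting point. *)
Lemma conn_to_decay (T : nat -> V -> set V) :
  (forall k u t, T k.+1 u t -> t \notin S u) ->
  (forall k u x y, x \in S u -> y \notin S u -> J x y != 0 -> T k.+1 u `<=` T k y) ->
  forall k u W, prob (fun c => conn_to c W u (T k u)) <= a ^+ k.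
Proof.
move=> TS Tstep; elim=> [|k IH] u W.
  by rewrite expr0; exact: (prob_le1 HJ b0 HP (@conn_to_dep _ _ _ _)).
apply: (le_trans (prob_exit (T := T k.+1 u) HJ b0 HP W (S_self u) _)); first exact: TS.
apply: (@le_trans _ _ (phi (S u) u W * a ^+ k)); last first.
  by rewrite exprS ler_wpM2r ?exprn_ge0 ?(a0 u).
rewrite /phi big_distrl /= big_seq [leRHS]big_seq; apply: ler_sum => x xS.
rewrite big_distrl /= big_seq [leRHS]big_seq; apply: ler_sum => y.
rewrite in_fsetD => /andP[yS yW].
have [J0|J0] := eqVneq (J x y) 0.
  have xy : x != y by apply: contraNneq yS => <-.
  by rewrite edge_prob2 // J0 mulr0 oppr0 expR0 subrr mulr0 !mul0r.
rewrite ler_wpM2l ?mulr_ge0 ?prob_ge0 //; apply: le_trans (IH y W).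
apply: (prob_le HJ b0 HP (@conn_to_dep _ _ _ _) (@conn_to_dep _ _ _ _)) => c.
by apply: conn_to_le => //; exact: (Tstep k u x y).
Qed.

End Subcritical.

(** * From finite windows to the infinite graph *)

Section InfiniteVolume.
Variables (R : realType) (V : choiceType) (J : V -> V -> R).
Hypothesis HJ : coupling_constants J.
Variables (d : measure_display) (Om : measurableType d) (opn : {fset V} -> set Om).
Variables (b : R) (P : probability Om R).
Hypotheses (b0 : 0 <= b) (HP : percolation_measure opn J b P).
Variable Wn : nat -> {fset V}.
Hypotheses (Wn_mono : forall m n, (m <= n)%N -> (Wn m `<=` Wn n)%fset)
  (Wn_exh : forall x, exists n, x \in Wn n).

Local Notation prob := (prob opn P).

Lemma exhaust_seq (s : seq V) : exists n, all (mem (Wn n)) s.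
Proof.
elim: s => [|x s [n sn]]; first by exists 0%N.
have [m xm] := Wn_exh x; exists (maxn m n) => /=; apply/andP; split.
  by move/fsubsetP : (Wn_mono (leq_maxl m n)); apply.
by apply: sub_all sn => y; move/fsubsetP : (Wn_mono (leq_maxr m n)); apply.
Qed.

(** A path is finite, hence contained in some window of the exhaustion. *)
Lemma connects_setE u T :
  connects_set opn u T = \bigcup_n [set w | conn_to (cfg opn w) (Wn n) u T].
Proof.
apply/seteqP; split => w.
  case=> y Ty [q uq uy]; have [n /= /andP[un qn]] := exhaust_seq (u :: q).
  exists n => //=; apply/asboolP; exists y; split => //.
    rewrite -uy; have : last u q \in u :: q by exact: mem_last.
    by rewrite inE => /predU1P[->//|/(allP qn)].
  apply/asboolP; exists q => //.
  apply: (@sub_in_path _ (mem (Wn n)) (open_pair opn w)) uq; last by apply/andP; split.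
  by move=> x z xW zW /andP[xz wxz]; apply/and4P; split.
case=> n _ /= /asboolP[y [yW Ty /asboolP[q uq uy]]]; exists y => //; exists q => //.
by apply: sub_path uq => x z /and4P[_ _ xz wxz]; apply/andP; split.
Qed.

Lemma measurable_conn_to W u T : measurable [set w | conn_to (cfg opn w) W u T].
Proof.
by apply: (measurable_cfg HP _ (@conn_to_dep _ W u T)); exact: edges_pairs.
Qed.

Lemma measurable_connects_set u T : measurable (connects_set opn u T).
Proof.
by rewrite connects_setE; apply: bigcupT_measurable => n; exact: measurable_conn_to.
Qed.

Lemma P_conn_to W u T : P [set w | conn_to (cfg opn w) W u T] =
  (prob (fun c => conn_to c W u T))%:E.
Proof. by rewrite fineK // fin_num_measure //; exact: measurable_conn_to. Qed.

Lemma cvg_connects_set u T :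
  (fun n => (prob (fun c => conn_to c (Wn n) u T))%:E) @ \oo --> P (connects_set opn u T).
Proof.
under eq_fun do rewrite -P_conn_to.
rewrite connects_setE; apply: nondecreasing_cvg_mu.
- by move=> n; exact: measurable_conn_to.
- by apply: bigcupT_measurable => n; exact: measurable_conn_to.
- move=> m n mn; apply/subsetPset => w /=; apply: conn_to_le => //; exact: Wn_mono.
Qed.

Lemma P_connects_set_le u T (B : R) :
  (forall W, prob (fun c => conn_to c W u T) <= B) ->
  (P (connects_set opn u T) <= B%:E)%E.
Proof.
move=> H; apply: (cvge_to_le (@cvg_connects_set u T)).
by apply: nearW => n; rewrite lee_fin.
Qed.

Lemma prob_le_connects_set W u T :
  ((prob (fun c => conn_to c W u T))%:E <= P (connects_set opn u T))%E.
Proof.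
rewrite -P_conn_to; apply: le_measure; rewrite ?inE.
- exact: measurable_conn_to.
- exact: measurable_connects_set.
move=> w /= /asboolP[y [yW Ty /asboolP[q uq uy]]]; exists y => //; exists q => //.
by apply: sub_path uq => x z /and4P[_ _ xz wxz]; apply/andP; split.
Qed.

Lemma connects_set1 u x : connects opn u x = connects_set opn u [set x].
Proof. by apply/seteqP; split => w; [exists x|case=> y ->]. Qed.

Lemma prob_conn_to1 W u x : x \in W ->
  prob (fun c => conn_to c W u [set x]) = prob (fun c => conn c W u x).
Proof.
move=> xW; congr (prob _); apply/funext => c; apply/asboolP/idP => [[y [_ -> //]]|ux].
by exists x.
Qed.

Lemma prob_union W u T :
  prob (fun c => conn_to c W u T) <=
  \sum_(x <- W | `[< T x >]) prob (fun c => conn c W u x).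
Proof.
rewrite (prob_E HJ HP (@conn_to_dep _ W u T)).
under eq_bigr do rewrite (prob_E HJ HP (@conn_dep _ W u _)).
rewrite -bern_sum; apply: (bern_le _ _ (edge_prob_param HJ b0)) => c.
case uT : (conn_to c W u T); last exact: sumr_ge0.
move/asboolP : uT => [y [yW Ty uy]].
apply: (le_trans _ (le_sum_mem (i := y) yW _ _)) => //; first by rewrite uy.
exact/asboolP.
Qed.

Section FiniteSusceptibility.
Variables (o : V) (B : R).
Hypothesis HB : forall W : {fset V}, o \in W ->
  \sum_(v <- W) prob (fun c => conn c W o v) <= B.

Lemma susceptibility_fset (A : {fset V}) :
  (\sum_(x <- A) P (connects opn o x) <= B%:E)%E.
Proof.
under eq_bigr do rewrite connects_set1.
have H : (fun n => (\sum_(x <- A) (prob (fun c => conn_to c (Wn n) o [set x]))%:E)%E)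
    @ \oo --> (\sum_(x <- A) P (connects_set opn o [set x]))%E.
  apply: cvg_nnesum => x _; first by apply: nearW => n; rewrite lee_fin prob_ge0.
  exact: (@cvg_connects_set o [set x]).
apply: (cvge_to_le H).
have [m /= /andP[om Am]] := exhaust_seq (o :: A).
near=> n.
have mn : (m <= n)%N by near: n; exact: nbhs_infty_ge.
have sub x : x \in Wn m -> x \in Wn n by move/fsubsetP : (Wn_mono mn); exact.
rewrite sumEFin lee_fin; apply: le_trans (HB (sub _ om)).
rewrite big_seq; under eq_bigr => x xA do rewrite (prob_conn_to1 _ (sub _ (allP Am _ xA))).
rewrite -big_seq.
have AW : (A `<=` Wn n)%fset by apply/fsubsetP => x /(allP Am); exact: sub.
apply: ler_sum_sub; rewrite ?fset_uniq //; first exact/fsubsetP.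
by move=> x; exact: prob_ge0.
Unshelve. all: by end_near. Qed.

Lemma susceptibility_esum : (\esum_(x in [set: V]) P (connects opn o x) < +oo)%E.
Proof.
apply: (@le_lt_trans _ _ B%:E); last exact: ltry.
apply: ub_ereal_sup => _ [A [Afin _] <-].
by rewrite fsbig_finite //; exact: susceptibility_fset.
Qed.

(** If targets disjoint from any given finite set were always reached with
probability at least [delta], infinitely many disjoint finite sets would each
carry a mass at least delta / 2 of the sum of connection probabilities, which
is bounded by [B]. *)
Lemma far_connection_small (T : nat -> set V) (delta : R) : 0 < delta ->
  (forall x, exists n, forall m, (n <= m)%N -> ~ T m x) ->
  ~ (forall n, (delta%:E <= P (connects_set opn o (T n)))%E).
Proof.
move=> d0 Tfar HT.
pose c x := fine (P (connects opn o x)).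
have cE x : P (connects opn o x) = (c x)%:E.
  by rewrite fineK // fin_num_measure // connects_set1; exact: measurable_connects_set.
have c0 x : 0 <= c x by rewrite -lee_fin -cE.
have cB (A : {fset V}) : \sum_(x <- A) c x <= B.
  by rewrite -lee_fin -sumEFin; under eq_bigr do rewrite -cE; exact: susceptibility_fset.
have avoid (A : {fset V}) : exists n, forall x, x \in A -> ~ T n x.
  suff [n hn] : exists n, forall m, (n <= m)%N -> forall x, x \in (A : seq V) -> ~ T m x.
    by exists n => x xA; exact: hn.
  elim: (A : seq V) => [|x s [n1 h1]]; first by exists 0%N.
  have [n2 h2] := Tfar x; exists (maxn n1 n2) => m; rewrite geq_max => /andP[m1 m2] y.
  by rewrite inE => /predU1P[->|/(h1 _ m1)//]; exact: h2.
(* Each step adds a set disjoint from the previous ones, of mass delta / 2. *)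
have acc k : exists A : {fset V}, k%:R * (delta / 2) <= \sum_(x <- A) c x.
  elim: k => [|k [A hA]]; first by exists fset0; rewrite mul0r sumr_ge0.
  have [n hn] := avoid A.
  have [W hW] : exists W, delta / 2 < prob (fun c => conn_to c W o (T n)).
    apply: contrapT => /forallNP hW.
    have : (P (connects_set opn o (T n)) <= (delta / 2)%:E)%E.
      by apply: P_connects_set_le => W; rewrite leNgt; apply/negP/hW.
    move=> /(le_trans (HT n)); rewrite lee_fin; lra.
  pose D := [fset x in W | `[< T n x >]]%fset.
  have AD : [disjoint A & D]%fset.
    apply/fdisjointP => x xA; rewrite !inE negb_and; apply/orP; right.
    by apply/asboolP; exact: hn.
  exists (A `|` D)%fset.
  have -> : \sum_(x <- (A `|` D)%fset) c x = \sum_(x <- A) c x + \sum_(x <- D) c x.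
    rewrite -big_cat; apply: perm_big; apply: uniq_perm.
    - exact: fset_uniq.
    - rewrite cat_uniq !fset_uniq andbT /=; apply/hasPn => x xD.
      by apply: contraTN xD => /(fdisjointP AD).
    - by move=> x; rewrite mem_cat in_fsetU.
  rewrite -natr1 mulrDl mul1r lerD // ltW // (lt_le_trans hW) //.
  apply: le_trans (prob_union _ _ _) _.
  apply: (@le_trans _ _ (\sum_(x <- W | `[< T n x >]) c x)).
    rewrite big_seq_cond [leRHS]big_seq_cond; apply: ler_sum => x /andP[xW _].
    by rewrite -prob_conn_to1 // -lee_fin -cE connects_set1 prob_le_connects_set.
  rewrite -big_filter (perm_big D) //; apply: uniq_perm.
  - exact/filter_uniq/fset_uniq.
  - exact: fset_uniq.
  - by move=> x; rewrite mem_filter !inE andbC.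
have B0 : 0 <= B by apply: le_trans (cB fset0); rewrite sumr_ge0.
have := truncnS_gt (B / (delta / 2)).
have [A] := acc (Num.truncn (B / (delta / 2))).+1.
move=> hA; rewrite ltr_pdivrMr ?divr_gt0 // => /(lt_le_trans) /(_ hA).
by rewrite ltNge cB.
Qed.

End FiniteSusceptibility.

End InfiniteVolume.

(** * The differential inequality *)

Section DifferentialInequality.
Variables (R : realType) (V : choiceType) (J : V -> V -> R).
Hypothesis HJ : coupling_constants J.
Variables (W : {fset V}) (o : V) (T : set V).
Hypothesis oW : o \in W.
Implicit Types (s t k : R) (S : {fset V}) (c : {fset V} -> bool).

Local Notation p := (edge_prob J).
Local Notation E t f := (bern (p t) (edges W) f (fun=> false)).

Definition reach_prob t : R := E t (fun c => (conn_to c W o T)%:R).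

Definition phi_in t S : R := \sum_(x <- S) \sum_(y <- (W `\` S)%fset)
  E t (fun c => (conn c S o x)%:R) * p t [fset x; y]%fset.

Definition reach_deriv t : R := \sum_(e <- edges W) edge_coupling J e *
  E t (fun c => (~~ c e)%:R *
    ((conn_to (upd c e true) W o T)%:R - (conn_to c W o T)%:R)).

Lemma is_derive_reach t : is_derive t 1 reach_prob (reach_deriv t).
Proof.
apply: bern_russo_closed; first exact: edges_uniq.
by move=> e; exact: is_derive_edge_prob.
Qed.

Lemma upd_true_le c e e' : c e' -> upd c e true e'.
Proof. by rewrite /upd; case: eqP. Qed.

(** Only S = [unconnected c W T] contributes to the left-hand side.  If it
contains [o], then every edge {x,y} with [y] outside it and [x] connected to
[o] inside it is closed, and opening it connects [o] to [T]; distinct pairs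
(x,y) give distinct edges. *)
Lemma pivotal_lower_bound c :
  \sum_(S <- fpowerset W | o \in S) \sum_(x <- S) \sum_(y <- (W `\` S)%fset)
    J x y * ((unconnected c W T == S)%:R * (conn c S o x)%:R) <=
  \sum_(e <- edges W) edge_coupling J e * ((~~ c e)%:R *
    ((conn_to (upd c e true) W o T)%:R - (conn_to c W o T)%:R)).
Proof.
have [_ J0] := HJ.
set S0 := unconnected c W T.
pose H e : R := edge_coupling J e * ((~~ c e)%:R *
    ((conn_to (upd c e true) W o T)%:R - (conn_to c W o T)%:R)).
have H0 e : 0 <= H e.
  rewrite /H mulr_ge0 ?edge_coupling_ge0 // mulr_ge0 // subr_ge0 ler_nat.
  case h : (conn_to c W o T) => //.
  by rewrite (conn_to_le (c := c) _ _ _ h) // => e'; exact: upd_true_le.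
have S0W : S0 \in fpowerset W.
  by rewrite fpowersetE; apply/fsubsetP => x; rewrite in_unconnected => /andP[].
rewrite [leLHS]big_mkcond /= (bigD1_seq S0) ?fset_uniq //= [X in _ + X <= _]big1 ?addr0; last first.
  move=> S SS0; case: ifP => // _; rewrite big1 // => x _; rewrite big1 // => y _.
  by rewrite eq_sym (negbTE SS0) mul0r mulr0.
case: ifP => [oS0|_]; last by apply: sumr_ge0 => e _; exact: H0.
pose r := [seq (x, y) | x <- S0, y <- (W `\` S0)%fset].
pose h (xy : V * V) : {fset V} := [fset xy.1; xy.2]%fset.
have mem_r x y : ((x, y) \in r) = (x \in S0) && (y \in (W `\` S0)%fset).
  by apply/allpairsP/andP => [[[x' y'] /= [xS yS [-> ->]]]|[xS yS]] //; exists (x, y).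
have ur : uniq r 
  by apply: allpairs_uniq; [exact: fset_uniq|exact: fset_uniq|move=> [? ?] [? ?] _ _ /= [-> ->]].
have hi : {in r &, injective h}.
  move=> [x y] [x' y']; rewrite !mem_r !in_fsetD => /and3P[xS yS yW] /and3P[xS' yS' yW'].
  rewrite /h /= => /fsetP hE; congr pair.
    have := hE x; rewrite !inE eqxx /= => /esym /orP[/eqP//|/eqP xy'].
    by rewrite -xy' xS in yS'.
  have := hE y; rewrite !inE eqxx orbT => /esym /orP[/eqP yx'|/eqP//].
  by rewrite yx' xS' in yS.
have -> : \sum_(x <- S0) \sum_(y <- (W `\` S0)%fset)
    J x y * ((S0 == S0)%:R * (conn c S0 o x)%:R) =
  \sum_(xy <- r) J xy.1 xy.2 * (conn c S0 o xy.1)%:R.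
  by rewrite big_allpairs; do 2 apply: eq_bigr => ? _; rewrite eqxx mul1r.
apply: (@le_trans _ _ (\sum_(xy <- r) H (h xy))); last first.
  rewrite -(big_map h xpredT); apply: ler_sum_sub => //.
  - by rewrite map_inj_in_uniq.
  - exact: edges_uniq.
  move=> e /mapP[[x y]]; rewrite mem_r in_fsetD => /and3P[xS yS yW] ->.
  apply: mem_edges2 => //=; first by move: xS; rewrite in_unconnected => /andP[].
  by apply: contraNneq yS => <-.
rewrite big_seq [leRHS]big_seq; apply: ler_sum => -[x y].
rewrite mem_r in_fsetD => /and3P[xS yS yW].
have xy : x != y by apply: contraNneq yS => <-.
rewrite /H /h /= edge_coupling2 // ler_wpM2l //.
have [xW xT] := andP (etrans (esym (in_unconnected c W T x)) xS).
have yT : conn_to c W y T.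
  by move: yS; rewrite in_unconnected yW /= negbK.
have -> : c [fset x; y]%fset = false.
  apply: contraNF xT => cxy; apply: conn_to_trans yT; apply: step_conn.
  exact/and4P.
have -> : conn_to c W o T = false.
  by move: oS0; rewrite in_unconnected => /andP[_ /negbTE].
rewrite mul1r subr0 ler_nat; case ox : (conn c S0 o x) => //.
have le_upd e' : c e' -> upd c [fset x; y]%fset true e' by exact: upd_true_le.
suff -> : conn_to (upd c [fset x; y]%fset true) W o T by [].
apply: (@conn_to_trans _ _ _ _ x).
  by apply: conn_le ox => //; rewrite -fpowersetE.
apply: (@conn_to_trans _ _ _ _ y).
  by apply: step_conn; apply/and4P; split; rewrite // /upd eqxx.
exact: conn_to_le yT.
Qed.

(** The set [S] of vertices not connected to [T] and the connections inside
[S] depend on disjoint sets of edges, so the bound on the pivotal edges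
factorizes; bounding t J(x,y) from below by the opening probability makes
[phi_in] appear, and the probabilities that the set is [S], for [S] containing
[o], add up to 1 - [reach_prob t]. *)
Lemma reach_deriv_ge t k : 0 <= t ->
  (forall S, o \in S -> (S `<=` W)%fset -> (forall x, x \in S -> ~ T x) ->
    k <= phi_in t S) ->
  k * (1 - reach_prob t) <= t * reach_deriv t.
Proof.
move=> t0 hk; have p01 := edge_prob_param HJ t0; have [_ J0] := HJ.
have lower : \sum_(S <- fpowerset W | o \in S) \sum_(x <- S) \sum_(y <- (W `\` S)%fset)
    J x y * (E t (fun c => (unconnected c W T == S)%:R) *
             E t (fun c => (conn c S o x)%:R)) <= reach_deriv t.
  rewrite /reach_deriv; under [leRHS]eq_bigr do rewrite -bernZ.
  rewrite -bern_sum; apply: le_trans (bern_le _ _ p01 pivotal_lower_bound).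
  rewrite bern_sum big_seq_cond [leRHS]big_seq_cond; apply: ler_sum => S /andP[SW oS].
  rewrite bern_sum; apply: ler_sum => x _.
  rewrite bern_sum; apply: ler_sum => y _.
  rewrite bernZ (@bern_indep _ _ [pred e | (e \in edges W) && ~~ (e `<=` S)%fset]) //.
    exact: (dep_comp (fun bb : bool => (bb%:R : R)) (@unconnected_dep _ W T S)).
  apply: dep_sub (dep_comp (fun bb : bool => (bb%:R : R)) (@conn_dep _ S o x)) => e.
  by rewrite -[_ \in _]/(e \in edges S) !inE mem_edges => /andP[_ ->]; rewrite andbF.
apply: le_trans (ler_wpM2l t0 lower).
have -> : 1 - reach_prob t =
    \sum_(S <- fpowerset W | o \in S) E t (fun c => (unconnected c W T == S)%:R).
  rewrite -bern_sum /reach_prob -[X in X - _](bern_cst (p t) (edges W) 1 (fun=> false)).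
  rewrite -mulN1r -bernZ -bernD; congr bern; apply/funext => c.
  rewrite sum_eq_indicator ?fset_uniq //.
    rewrite in_unconnected oW; case: (conn_to c W o T) => /=; ring.
  by rewrite fpowersetE; apply/fsubsetP => x; rewrite in_unconnected => /andP[].
rewrite !big_distrr /= big_seq_cond [leRHS]big_seq_cond.
apply: ler_sum => S /andP[SW oS].
have un0 : 0 <= E t (fun c => (unconnected c W T == S)%:R) by exact: bern_ge0.
have [ST|] := pselect (forall x, x \in S -> ~ T x); last first.
  move=> /existsNP[x /not_implyP[xS /contrapT Tx]].
  have -> : E t (fun c => (unconnected c W T == S)%:R) = 0.
    rewrite -[RHS](bern_cst (p t) (edges W) 0 (fun=> false)); congr bern.
    apply/funext => c; case: eqP => // SE; move: xS; rewrite -SE in_unconnected.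
    case/andP=> xW /negP[]; apply/asboolP; exists x; split => //; exact: conn_refl.
  rewrite mulr0 mulr_ge0 //; apply: sumr_ge0 => x' _; apply: sumr_ge0 => y _.
  by rewrite mul0r mulr0.
rewrite fpowersetE in SW.
apply: le_trans (ler_wpM2r un0 (hk S oS SW ST)) _.
rewrite /phi_in big_distrl big_distrr /= big_seq [leRHS]big_seq; apply: ler_sum => x xS.
rewrite big_distrl big_distrr /= big_seq [leRHS]big_seq; apply: ler_sum => y.
rewrite in_fsetD => /andP[yS _].
have xy : x != y by apply: contraNneq yS => <-.
have := edge_prob_le_coupling J t [fset x; y]%fset; rewrite edge_coupling2 // => pJ.
set A := E t _; set B := E t _ in un0 *; set q := p t _ in pJ *.
have A0 : 0 <= A by exact: bern_ge0.
have -> : A * q * B = q * (A * B) by ring.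
have -> : t * (J x y * (B * A)) = t * J x y * (A * B) by ring.
by rewrite ler_wpM2r // mulr_ge0.
Qed.

Lemma phi_in_mono s t S : 0 <= s -> s <= t -> phi_in s S <= phi_in t S.
Proof.
move=> s0 st; have t0 := le_trans s0 st.
have ps := edge_prob_param HJ s0; have pt := edge_prob_param HJ t0.
have pst e := edge_prob_le HJ e st.
apply: ler_sum => x _; apply: ler_sum => y _; apply: ler_pM => //.
- exact: bern_ge0.
- by case/andP: (ps [fset x; y]%fset).
apply: bern_le_param => // c c' cc; rewrite ler_nat.
case h : (conn c S o x) => //.
by rewrite (conn_le (c := c) _ _ h).
Qed.

(** The function (1 - F(r)) r - (1 - k) r is nonincreasing on [s, t]: its
derivative is 1 - F - r F' - (1 - k), at most - (1 - k) F by the differential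
inequality.  This form of the integration avoids powers of r. *)
Lemma reach_prob_lower_bound s t k : 0 <= s -> s < t -> k <= 1 ->
  (forall S, o \in S -> (S `<=` W)%fset -> (forall x, x \in S -> ~ T x) ->
    k <= phi_in s S) ->
  (1 - reach_prob t) * t <= s + (1 - k) * (t - s).
Proof.
move=> s0 st k1 hk.
have F0 r : s <= r -> 0 <= reach_prob r.
  by move=> sr; apply: bern_ge0 => //; exact: edge_prob_param (le_trans s0 sr).
pose h r : R := (1 - reach_prob r) * r - (1 - k) * r.
pose dh r : R := (1 - reach_prob r) - r * reach_deriv r - (1 - k).
have hd (r : R) : is_derive r 1 h (dh r).
  have D := is_derive_reach r.
  have := is_deriveB (is_deriveM (is_deriveB (is_derive_cst (1 : R) r (1 : R)) D)
    (is_derive_id r (1 : R))) (is_deriveM (is_derive_cst (1 - k) r (1 : R)) (is_derive_id r (1 : R))).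
  move=> Dh; apply: (is_derive_eq Dh); rewrite /dh /GRing.scale /=.
  rewrite -[(cst 1 - reach_prob) r]/(1 - reach_prob r); ring.
have [|r rst hr] := @MVT _ h dh s t st (fun x _ => hd x).
  apply: derivable_within_continuous => x _; exact: ex_derive.
have {}rst : s <= r by move: rst; rewrite in_itv => /andP[/ltW].
have r0 := le_trans s0 rst.
have dle : dh r <= 0.
  have := @reach_deriv_ge r k r0 (fun S oS SW ST => le_trans (hk S oS SW ST) (phi_in_mono S s0 rst)).
  have := F0 r rst; rewrite /dh; nra.
have : h t <= h s by rewrite -subr_le0 hr mulr_le0_ge0 // subr_ge0 ltW.
have := F0 s (lexx s); rewrite /h; nra.
Qed.

End DifferentialInequality.

(** * Invariance under automorphisms *)

Section Invariance.
Variables (R : realType) (V : choiceType) (J : V -> V -> R).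
Hypothesis HJ : coupling_constants J.
Variables (d : measure_display) (Om : measurableType d) (opn : {fset V} -> set Om).
Variables (b : R) (P : probability Om R).
Hypotheses (b0 : 0 <= b) (HP : percolation_measure opn J b P).
Variables (g g' : V -> V).
Hypotheses (gK : cancel g g') (g'K : cancel g' g) (gJ : forall x y, J (g x) (g y) = J x y).
Implicit Types (S W : {fset V}) (c : {fset V} -> bool).

Let g_inj : injective g := can_inj gK.

Lemma perm_imfset S : perm_eq (g @` S)%fset [seq g x | x <- S].
Proof.
apply: uniq_perm; rewrite ?fset_uniq ?map_inj_uniq ?fset_uniq // => x.
by apply/imfsetP/mapP => -[y yS ->]; exists y.
Qed.

Definition edge_map (e : {fset V}) : {fset V} := (g @` e)%fset.

Lemma edge_map_inj : injective edge_map.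
Proof.
have memE e x : (g x \in edge_map e) = (x \in e) by exact: mem_imfset.
by move=> e e' ee; apply/fsetP => x; rewrite -memE ee memE.
Qed.

Lemma edge_prob_map e : edge_prob J b (edge_map e) = edge_prob J b e.
Proof.
rewrite /edge_prob /edge_coupling (perm_big _ (perm_imfset e)) big_map.
congr (1 - expR (- (b * (_ / 2)))).
apply: eq_bigr => x _; rewrite (perm_big _ (perm_imfset e)) big_map.
by apply: eq_big => [y|y _]; rewrite ?(inj_eq g_inj).
Qed.

Lemma step_map c S x y : step c (g @` S)%fset (g x) (g y) = step (c \o edge_map) S x y.
Proof.
by rewrite /step !mem_imfset // (inj_eq g_inj) /= /edge_map imfsetU !imfset_fset1.
Qed.

Lemma conn_map c S x y :
  conn c (g @` S)%fset (g x) (g y) = conn (c \o edge_map) S x y.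
Proof.
apply/idP/idP => xy.
  have [y' /g_inj -> //] : exists2 y', g y = g y' & conn (c \o edge_map) S x y'.
  move: (g y) xy; apply: (conn_ind (Q := fun z => exists2 y', z = g y' &
    conn (c \o edge_map) S x y')); first by exists x => //; exact: conn_refl.
  move=> a z _ [a' -> xa'] az; have zS : z \in (g @` S)%fset by case/and4P: az.
  case/imfsetP : zS az => z' _ -> az; exists z' => //.
  by apply: conn_trans xa' _; apply: step_conn; rewrite -step_map.
move: y xy; apply: (conn_ind (Q := fun y => conn c (g @` S)%fset (g x) (g y))).
  exact: conn_refl.
move=> a z _ xa az; apply: conn_trans xa _; apply: step_conn.
by rewrite step_map.
Qed.

Lemma prob_conn_map S x y :
  prob opn P (fun c => conn c (g @` S)%fset (g x) (g y)) =
  prob opn P (fun c => conn c S x y).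
Proof.
have -> : (fun c => conn c (g @` S)%fset (g x) (g y)) =
    (fun c => conn (c \o edge_map) S x y).
  by apply/funext => c; rewrite conn_map.
rewrite (prob_bern HJ HP (s := [seq edge_map e | e <- edges S])).
- rewrite (bern_map (edge_prob J b) _ (fun c => (conn c S x y)%:R) _ edge_map_inj).
  rewrite (prob_edges HJ HP (@conn_dep _ S x y)).
  by congr bern; apply/funext => e; exact: edge_prob_map.
- rewrite map_inj_uniq; [exact: edges_uniq|exact: edge_map_inj].
- move=> e /mapP[e0]; rewrite mem_edges => /andP[/eqP e2 _] ->.
  by rewrite /edge_map card_imfset.
- move=> c c' cc; apply: (@conn_dep _ S x y) => e eS /=; apply: cc.
  exact: map_f.
Qed.

(** The automorphism moves the window as well, which is harmless as the bounds
on [phi] are uniform in the window. *)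
Lemma phi_map S u W :
  phi J opn b P (g @` S)%fset (g u) W = phi J opn b P S u (g' @` W)%fset.
Proof.
rewrite /phi (perm_big _ (perm_imfset S)) big_map; apply: eq_bigr => x _.
have -> : (W `\` g @` S)%fset = (g @` (g' @` W `\` S))%fset.
  have mg (A : {fset V}) z : (g z \in (g @` A)%fset) = (z \in A) by exact: mem_imfset.
  have mg' (A : {fset V}) z : (g' z \in (g' @` A)%fset) = (z \in A).
    by apply: mem_imfset; exact: can_inj g'K.
  by apply/fsetP => y; rewrite -(g'K y) mg !in_fsetD mg mg' g'K.
rewrite (perm_big _ (perm_imfset _)) big_map; apply: eq_bigr => y _.
rewrite prob_conn_map; congr (_ * _).
by rewrite -[RHS]edge_prob_map /edge_map imfsetU !imfset_fset1.
Qed.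

End Invariance.

(** * Isolated vertices *)

Section Isolation.
Variables (R : realType) (V : choiceType) (J : V -> V -> R).
Hypothesis HJ : coupling_constants J.
Variables (d : measure_display) (Om : measurableType d) (opn : {fset V} -> set Om).
Variables (b : R) (P : probability Om R).
Hypotheses (b0 : 0 <= b) (HP : percolation_measure opn J b P).

(** To leave [u], one of its edges must be open. *)
Lemma prob_conn_to_isolated (W : {fset V}) (u : V) (T : set V) : ~ T u ->
  prob opn P (fun c => conn_to c W u T) <=
  1 - expR (- (b * \sum_(y <- (W `\ u)%fset) J u y)).
Proof.
move=> Tu; pose B := [seq [fset u; y]%fset | y <- (W `\ u)%fset].
have yu y : y \in (W `\ u)%fset -> u != y.
  by rewrite in_fsetD1 eq_sym => /andP[].
have uB : uniq B.
  rewrite map_inj_in_uniq ?fset_uniq // => y y' yW y'W /fsetP /(_ y).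
  rewrite !inE eqxx orbT => /esym /orP[/eqP yE|/eqP//].
  by have := yu _ yW; rewrite yE eqxx.
have pB e : e \in B -> #|` e|%fset = 2%N.
  by case/mapP => y /yu uy ->; rewrite cardfs2 uy.
have PB : P (cylinder opn [::] B) = (expR (- (b * \sum_(y <- (W `\ u)%fset) J u y)))%:E.
  rewrite (P_cylinder HJ HP) // big_nil mul1r big_map; congr _%:E.
  rewrite big_distrr /= -sumrN expR_sum big_seq [RHS]big_seq; apply: eq_bigr => y yW.
  by rewrite edge_prob2 ?yu // opprB addrC subrK.
have mB : measurable (cylinder opn [::] B) by apply: (measurable_cylinder HP).
have mT : measurable [set w | conn_to (cfg opn w) W u T].
  by apply: (measurable_cfg HP _ (@conn_to_dep _ W u T)); exact: edges_pairs.
rewrite -lee_fin /prob fineK ?fin_num_measure // EFinB -PB -probability_setC //.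
apply: le_measure; rewrite ?inE //; first exact: measurableC.
move=> w /= uT /andP[_ /allP wB].
have : conn (cfg opn w) W u u by exact: conn_refl.
case/asboolP : uT => t [tW Tt /asboolP[[|y q] /= uq ut] _].
  by apply: Tu; rewrite ut.
case/andP : uq => /and4P[uW yW uy wuy] _.
have := wB [fset u; y]%fset; rewrite /= wuy => H.
suff : false by [].
by apply: H; apply: map_f; rewrite in_fsetD1 eq_sym uy.
Qed.

End Isolation.

(** * Subcritical and other parameters *)

Section Dichotomy.
Variables (R : realType) (V : choiceType) (adj : rel V) (o : V)
    (J : V -> V -> R)
    (d : measure_display) (Om : measurableType d)
    (opn : {fset V} -> set Om).
Hypotheses (adj_simple : simple_graph adj)
    (adj_connected : connected_graph adj)
    (adj_locally_finite : locally_finite adj)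
    (HJ : coupling_constants J).

Let adj_sym : symmetric adj. Proof. by case: adj_simple. Qed.
Let gfin n := gball_finite adj_sym adj_connected adj_locally_finite o n.

Definition fball n : {fset V} := fset_set (gball adj o n).

Lemma in_fball n x : (x \in fball n) = (gdist adj x o <= n)%N.
Proof. by rewrite in_fset_set ?gfin //; apply/idP/idP; rewrite inE. Qed.

Lemma fball_mono m n : (m <= n)%N -> (fball m `<=` fball n)%fset.
Proof. by move=> mn; apply/fsubsetP => x; rewrite !in_fball => /leq_trans; apply. Qed.

Lemma fball_exh x : exists n, x \in fball n.
Proof. by exists (gdist adj x o); rewrite in_fball. Qed.

Lemma connects_inftyE :
  connects_infty opn adj o = \bigcap_n connects_set opn o (~` gball adj o n.+1).
Proof.
apply/seteqP; split => w H; first by move=> n _; exact: H.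
by case=> [//|n] _; exact: (H n).
Qed.

Lemma measurable_connects_infty (b : R) (P : probability Om R) :
  percolation_measure opn J b P -> measurable (connects_infty opn adj o).
Proof.
move=> HP; rewrite connects_inftyE; apply: bigcapT_measurable => n.
exact: (measurable_connects_set HP fball_mono fball_exh).
Qed.

(** The bound being uniform in [W], it says that the sum over all [y] outside
[S] is less than 1. *)
Definition subcritical b (P : probability Om R) :=
  exists S a, [/\ o \in S, a < 1 & forall W, phi J opn b P S o W <= a].

Section Supercritical.
Variables (s t : R) (Ps Pt : probability Om R).
Hypotheses (s0 : 0 <= s) (st : s < t).
Hypotheses (HPs : percolation_measure opn J s Ps) (HPt : percolation_measure opn J t Pt).

Lemma phi_le_window S W W' : (W `<=` W')%fset ->
  phi J opn s Ps S o W <= phi J opn s Ps S o W'.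
Proof.
move=> WW; apply: ler_sum => x _; apply: ler_sum_sub; rewrite ?fset_uniq //.
  by move=> y; rewrite !in_fsetD => /andP[-> /(fsubsetP WW)].
move=> y; rewrite mulr_ge0 ?prob_ge0 //.
by have /andP[] := edge_prob_param HJ s0 [fset x; y]%fset.
Qed.

(** The window [W] is chosen so large that [phi] is at least [k] at the
parameter [s] for every set in the ball: there are finitely many such sets, and
[phi] grows with the window.  Then [k] tends to 1. *)
Lemma supercritical_connects_set n : ~ subcritical s Ps ->
  ((1 - s / t)%:E <= Pt (connects_set opn o (~` gball adj o n)))%E.
Proof.
move=> nsub; set T := ~` gball adj o n.
have t0 : 0 < t by exact: le_lt_trans st.
have mT : measurable (connects_set opn o T).
  exact: (measurable_connects_set HPt fball_mono fball_exh).
rewrite -[leRHS]fineK ?fin_num_measure // lee_fin; set q := fine _.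
suff H e : 0 < e -> (1 - q) * t <= s + e.
  have : (1 - q) * t <= s by apply/ler_addgt0Pr => e; exact: H.
  by move=> h; rewrite lerBlDr -lerBlDl ler_pdivlMr.
move=> e0; (* The defect 1 - k is tuned so that the error term (1 - k) (t - s) is e. *)
pose k := 1 - e / (t - s).
have k1 : k < 1 by rewrite ltrBlDr ltrDl divr_gt0 // subr_gt0.
have [W [BW hW]] : exists W, (fball n `<=` W)%fset /\
    forall S, S \in (fpowerset (fball n) : seq _) -> o \in S -> k <= phi J opn s Ps S o W.
  elim: (fpowerset (fball n) : seq _) => [|S r [W [BW IH]]].
    by exists (fball n); split.
  have [oS|oS] := boolP (o \in S); last first.
    by exists W; split => // S'; rewrite inE => /predU1P[-> /(negP oS)|/IH].
  have [W' hW'] : exists W', k < phi J opn s Ps S o W'.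
    apply: contrapT => /forallNP hN; apply: nsub; exists S, k; split => // W'.
    by rewrite leNgt; apply/negP/hN.
  exists (W `|` W')%fset; split; first exact: fsubset_trans BW (fsubsetUl _ _).
  move=> S'; rewrite inE => /predU1P[-> _|S'r oS'].
    by apply: le_trans (ltW hW') _; apply: phi_le_window; exact: fsubsetUr.
  by apply: le_trans (IH _ S'r oS') _; apply: phi_le_window; exact: fsubsetUl.
have oW : o \in W by apply: (fsubsetP BW); rewrite in_fball gdistxx.
have := @reach_prob_lower_bound _ _ _ HJ W o T oW s t k s0 st (ltW k1).
have -> : reach_prob J W o T t = prob opn Pt (fun c => conn_to c W o T).
  by rewrite (prob_edges HJ HPt (@conn_to_dep _ W o T)).
move=> H; have {}H : (1 - prob opn Pt (fun c => conn_to c W o T)) * t <=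
    s + (1 - k) * (t - s).
  apply: H => S oS SW ST.
  have -> : phi_in J W o s S = phi J opn s Ps S o W.
    apply: eq_bigr => x _; apply: eq_bigr => y _; congr (_ * _).
    by rewrite (prob_E HJ HPs (dep_edges_sub SW (@conn_dep _ S o x))).
  apply: hW => //; rewrite -[_ \in _]/(S \in fpowerset (fball n)) fpowersetE; apply/fsubsetP => x /ST.
  by rewrite in_fball /T /gball /= => /contrapT.
have ke : (1 - k) * (t - s) = e.
  by rewrite /k opprB addrC subrK divfK // subr_eq0 gt_eqF.
rewrite ke in H; apply: le_trans H.
rewrite ler_pM2r // lerD2l lerN2 -lee_fin /q [X in (_ <= X)%E]fineK ?fin_num_measure //.
exact: (prob_le_connects_set HPt fball_mono fball_exh).
Qed.

Lemma supercritical_connects_infty : ~ subcritical s Ps ->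
  ((1 - s / t)%:E <= Pt (connects_infty opn adj o))%E.
Proof.
move=> nsub; rewrite connects_inftyE.
have mF n : measurable (connects_set opn o (~` gball adj o n.+1)).
  exact: (measurable_connects_set HPt fball_mono fball_exh).
have H : Pt \o (fun n => connects_set opn o (~` gball adj o n.+1)) @ \oo -->
    Pt (\bigcap_n connects_set opn o (~` gball adj o n.+1)).
  apply: nonincreasing_cvg_mu => //.
  - by rewrite (le_lt_trans (probability_le1 _ _)) ?ltry.
  - exact: bigcapT_measurable.
  - move=> m n mn; apply/subsetPset => w [y yn oy]; exists y => //.
    by move=> ym; apply: yn; rewrite /gball /= (leq_trans ym).
apply: (cvge_to_ge H); apply: nearW => n; exact: supercritical_connects_set.
Qed.

End Supercritical.

Section SubcriticalCase.
Variables (b : R) (P : probability Om R).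
Hypotheses (b0 : 0 <= b) (HP : percolation_measure opn J b P).
Hypothesis J_invariant : invariant_couplings adj J.
Hypothesis Psub : subcritical b P.

(** The translates of [S] by automorphisms mapping the origin to [u] satisfy
the same bounds at [u]. *)
Lemma subcritical_everywhere : exists S a L, [/\ a < 1,
  (forall u, u \in S u), (forall u W, phi J opn b P (S u) u W <= a) ,
  (forall u, #|` S u|%fset = #|` S o|%fset) &
  forall u x, x \in S u -> (gdist adj x u <= L)%N].
Proof.
have [S [a [oS a1 hS]]] := Psub.
have [Gam [[Gaut _ _ Ginv] Gtrans GJ]] := J_invariant.
have gchoice u : exists gg : (V -> V) * (V -> V),
    [/\ Gam gg.1, gg.1 o = u, cancel gg.1 gg.2 & cancel gg.2 gg.1].
  have [g Gg go] := Gtrans o u; have [h [_ gh hg]] := Ginv _ Gg.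
  by exists (g, h).
have [G GP] := choice gchoice.
have [L SL] := exhaust_seq fball_mono fball_exh S.
exists (fun u => ((G u).1 @` S)%fset), a, L; split => //.
- move=> u; have [_ gu gK _] := GP u.
  by rewrite -[X in X \in _]gu mem_imfset //; exact: can_inj gK.
- move=> u W; have [Gg gu gK g'K] := GP u.
  by rewrite -[X in phi _ _ _ _ _ X _]gu (phi_map HJ HP gK g'K (GJ _ Gg)).
- move=> u; have [_ _ gK _] := GP u; have [_ _ gK' _] := GP o.
  by rewrite !card_imfset //; [exact: can_inj gK'|exact: can_inj gK].
- move=> u x; have [Gg gu gK _] := GP u; case/imfsetP => y /= yS ->.
  rewrite -[X in gdist _ _ X]gu (gdist_automorphism adj_connected); last exact: Gaut.
  by rewrite -in_fball; exact: (allP SL).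
Qed.

Lemma subcritical_susceptibility : exists B, forall W : {fset V}, o \in W ->
  \sum_(v <- W) prob opn P (fun c => conn c W o v) <= B.
Proof.
have [S [a [L [a1 Sself Sphi Scard _]]]] := subcritical_everywhere.
exists ((#|` S o|%fset)%:R / (1 - a)) => W oW.
by apply: (susceptibility_le HJ b0 HP Sself Sphi a1) => // u; rewrite Scard.
Qed.

Lemma subcritical_esum : (\esum_(x in [set: V]) P (connects opn o x) < +oo)%E.
Proof.
have [B HB] := subcritical_susceptibility.
exact: (susceptibility_esum HP fball_mono fball_exh HB).
Qed.

Lemma subcritical_connects_infty : P (connects_infty opn adj o) = 0%E.
Proof.
have mF n : measurable (connects_set opn o (~` gball adj o n.+1)).
  exact: (measurable_connects_set HP fball_mono fball_exh).
have mI := measurable_connects_infty HP.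
have [B HB] := subcritical_susceptibility.
apply/eqP; rewrite eq_le measure_ge0 andbT leNgt; apply/negP => Ppos.
have fE : P (connects_infty opn adj o) = (fine (P (connects_infty opn adj o)))%:E.
  by rewrite fineK // fin_num_measure.
have d0 : 0 < fine (P (connects_infty opn adj o)) by rewrite -lte_fin -fE.
apply: (far_connection_small HJ b0 HP fball_mono fball_exh HB
  (T := fun n => ~` gball adj o n.+1) d0).
- move=> x; exists (gdist adj x o) => m xm; apply.
  by rewrite /gball /= (leq_trans xm).
- move=> n; rewrite -fE; apply: le_measure; rewrite ?inE // connects_inftyE.
  exact: bigcap_inf.
Qed.

(** The bound a ^ (n / M) from iterated exits is void for n < M; there, the
probability [q] that the origin is not isolated is used instead. *)
Lemma subcritical_decay : finite_range adj J ->
  exists2 c : R, 0 < c & forall n : nat,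
    (P (connects_set opn o (~` gball adj o n)) <= (expR (- (c * n%:R)))%:E)%E.
Proof.
move=> [r r0 Jr].
have [S [a [L [a1 Sself Sphi _ SL]]]] := subcritical_everywhere.
(* One exit from [S u] moves by at most [L] inside [S u] and then [rn]. *)
pose rn := (Num.truncn r).+1; have rrn : r < rn%:R by exact: truncnS_gt.
have Jrn x y : J x y != 0 -> (gdist adj x y <= rn)%N.
  move=> Jxy; rewrite leqNgt; apply/negP => h; move/eqP : Jxy; apply; apply: Jr.
  by apply: lt_trans rrn _; rewrite ltr_nat.
pose M := (L + rn)%N.
have decay k W : prob opn P (fun c => conn_to c W o (~` gball adj o (k * M))) <= a ^+ k.
  apply: (conn_to_decay HJ b0 HP Sself Sphi (T := fun k u => ~` gball adj u (k * M))).
  - move=> {}k u t /= ut; apply/negP => /SL tu; apply: ut; rewrite /gball /=.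
    by rewrite (leq_trans tu) // mulSn /M -addnA leq_addr.
  - move=> {}k u x y xS _ /Jrn xy t ut ty; apply: ut; rewrite /gball /=.
    have yu : (gdist adj y u <= M)%N.
      apply: leq_trans (gdist_triangle adj_connected y x u) _.
      by rewrite /M addnC leq_add ?SL // gdist_sym.
    apply: leq_trans (gdist_triangle adj_connected t y u) _.
    by rewrite mulSn addnC leq_add.
pose K := \sum_(y <- fball rn) J o y.
have [Js J0] := HJ.
pose q := 1 - expR (- (b * K)).
have q1 : q < 1 by rewrite ltrBlDr ltrDl expR_gt0.
have first_step W : prob opn P (fun c => conn_to c W o (~` gball adj o 0)) <= q.
  apply: le_trans (prob_conn_to_isolated HJ HP W _) _.
    by rewrite /= /gball /= gdistxx; apply.
  rewrite lerD2l lerN2 ler_expR lerN2 ler_wpM2l //.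
  rewrite (bigID (fun y => y \in fball rn)) /= [X in _ + X]big1 ?addr0; last first.
    move=> y; rewrite in_fball => yrn; apply/eqP; apply: contraNT yrn => /Jrn.
    by rewrite gdist_sym.
  rewrite -big_filter; apply: ler_sum_sub => [|||y]; last exact: J0.
  - exact/filter_uniq/fset_uniq.
  - exact: fset_uniq.
  - by move=> y; rewrite mem_filter => /andP[].
have a0 : 0 <= a.
  by have := decay 1%N fset0; rewrite expr1; apply: le_trans; exact: prob_ge0.
(* The third term 1 / 2 only ensures that [ln m] makes sense. *)
pose m := Num.max (Num.max a q) (1 / 2).
have m0 : 0 < m by rewrite lt_max; apply/orP; right; lra.
have m1 : m < 1 by rewrite !gt_max a1 q1; lra.
have am : a <= m by rewrite !le_max lexx.
have qm : q <= m by rewrite !le_max lexx orbT.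
have lnm : ln m < 0 by apply: ln_lt0; rewrite m0.
have M0 : (0 < M)%N by rewrite /M /rn addnS.
exists (- ln m / (2 * M%:R)).
  by rewrite divr_gt0 ?oppr_gt0 // mulr_gt0 // ltr0n.
(* n / (2 M) <= max (1, floor (n / M)) gives the same rate for all n. *)
move=> n; pose k := maxn 1 (n %/ M).
apply: (@le_trans _ _ (m ^+ k)%:E).
  apply: (P_connects_set_le HP fball_mono fball_exh) => W.
  rewrite /k; case: (leqP 1 (n %/ M)) => nM.
    apply: (@le_trans _ _ (a ^+ (n %/ M))).
      apply: le_trans (decay (n %/ M)%N W).
      apply: (prob_le HJ b0 HP (@conn_to_dep _ _ _ _) (@conn_to_dep _ _ _ _)) => c.
      apply: conn_to_le => // x xn xM; apply: xn; rewrite /gball /=.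
      exact: leq_trans (leq_trunc_div n M).
    by apply: lerXn2r; rewrite ?nnegrE // ltW.
  rewrite expr1; apply: le_trans qm; apply: le_trans (first_step W).
  apply: (prob_le HJ b0 HP (@conn_to_dep _ _ _ _) (@conn_to_dep _ _ _ _)) => c.
  apply: conn_to_le => // x xn xM; apply: xn; rewrite /gball /=.
  exact: leq_trans xM _.
rewrite lee_fin -[X in X ^+ _](@lnK _ m) ?posrE // -expRM_natl ler_expR.
have nk : (n <= 2 * M * k)%N.
  have := divn_eq n M; have := ltn_pmod n M0; rewrite /k; nia.
have : n%:R <= 2 * M%:R * k%:R :> R by rewrite -!natrM ler_nat.
have M0' : 0 < 2 * M%:R :> R by rewrite mulr_gt0 // ltr0n.
rewrite -ler_pdivrMl // => h.
rewrite mulNr mulNr opprK -mulrA [leLHS]mulrC.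
by apply: ler_wnM2l => //; exact: ltW.
Qed.

End SubcriticalCase.
End Dichotomy.

(** * Sharpness *)

Theorem theorem1p1 (R : realType) (V : choiceType) (adj : rel V) (o : V)
    (J : V -> V -> R)
    (d : measure_display) (Om : measurableType d)
    (opn : {fset V} -> set Om) (P : R -> probability Om R)
    (adj_simple : simple_graph adj)
    (adj_connected : connected_graph adj)
    (adj_locally_finite : locally_finite adj)
    (adj_transitive : vertex_transitive adj)
    (V_infinite : infinite_set [set: V])
    (J_coupling : coupling_constants J)
    (J_invariant : invariant_couplings adj J)
    (P_percolation : forall beta : R, 0 <= beta ->
       percolation_measure opn J beta (P beta)) :
  let beta_c := critical_beta opn adj o P in
  [/\ forall beta : R, (beta_c < beta%:E)%E ->
        ((beta%:E - beta_c) * (beta^-1)%:E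
           <= P beta (connects_infty opn adj o))%E,
      forall beta : R, 0 <= beta -> (beta%:E < beta_c)%E ->
        (\esum_(x in [set: V]) P beta (connects opn o x) < +oo)%E &
      finite_range adj J ->
      forall beta : R, 0 <= beta -> (beta%:E < beta_c)%E ->
        exists2 c : R, 0 < c & forall n : nat,
          (P beta (connects_set opn o (~` gball adj o n))
             <= (expR (- (c * n%:R)))%:E)%E].
Proof.
move=> beta_c.
have below beta : 0 <= beta -> (beta%:E < beta_c)%E ->
    subcritical o J opn beta (P beta).
  move=> b0 bc; apply: contrapT => nsub; move: bc; rewrite ltNge => /negP; apply.
  apply/lee_addgt0Pr => e e0; apply: ereal_inf_lbound; exists (beta + e) => //.
  have be : beta < beta + e by rewrite ltrDl.
  have be0 : 0 <= beta + e by rewrite addr_ge0 // ltW.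
  split => //.
  have := supercritical_connects_infty adj_simple adj_connected adj_locally_finite
    J_coupling b0 be (P_percolation _ b0) (P_percolation _ be0) nsub.
  apply: lt_le_trans; rewrite lte_fin subr_gt0 ltr_pdivrMr ?mul1r //.
  exact: le_lt_trans be.
split.
- move=> beta bc.
  have bc0 : (0 <= beta_c)%E.
    by apply: le_ereal_inf_tmp => _ [b [b0 _] <-]; rewrite lee_fin.
  have b0 : 0 < beta by rewrite -lte_fin (le_lt_trans bc0).
  set I := P beta _.
  have I1 : (I <= 1)%E.
    apply: probability_le1.
    exact: (measurable_connects_infty o adj_simple adj_connected
      adj_locally_finite (P_percolation _ (ltW b0))).
  have IE : I = (fine I)%:E.
    by rewrite fineK // ge0_fin_numE ?measure_ge0 // (le_lt_trans I1) ?ltry.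
  (* Every percolating parameter [s] below [beta] satisfies
     1 - s / beta <= P[0 <-> infinity]: this is a lower bound on such [s]. *)
  have low : ((beta * (1 - fine I))%:E <= beta_c)%E.
    apply: le_ereal_inf_tmp => _ [s [s0 Ps] <-]; rewrite lee_fin.
    have [bs|sb] := leP beta s.
      apply: le_trans bs; rewrite ler_piMr ?(ltW b0) // gerBl -lee_fin -IE.
      exact: measure_ge0.
    have nsub : ~ subcritical o J opn s (P s).
      move=> sub; move: Ps; rewrite (subcritical_connects_infty adj_simple
        adj_connected adj_locally_finite J_coupling s0 (P_percolation _ s0) J_invariant sub).
      by rewrite ltxx.
    have := supercritical_connects_infty adj_simple adj_connected adj_locally_finite
      J_coupling s0 sb (P_percolation _ s0) (P_percolation _ (ltW b0)) nsub.
    rewrite -/I IE lee_fin => h.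
    by rewrite mulrC -ler_pdivlMr // lerBlDl -lerBlDr.
  move: bc low; case: beta_c bc0 {below} => [x| |] //= _ _.
  rewrite lee_fin => low; rewrite IE -EFinB -EFinM lee_fin ler_pdivrMr //; nra.
- move=> beta b0 bc; have sub := below _ b0 bc.
  exact: (subcritical_esum adj_simple adj_connected adj_locally_finite J_coupling b0
    (P_percolation _ b0) J_invariant sub).
- move=> fr beta b0 bc; have sub := below _ b0 bc.
  exact: (subcritical_decay adj_simple adj_connected adj_locally_finite J_coupling b0
    (P_percolation _ b0) J_invariant sub).
Qed.
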